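(* Let $G=(V,E)$ be an oriented 3-edge-connected graph with $\ell=|E|-|V|\ge 11$ and let $f:E\to\mathbb{Z}_6$. Then there exist at least $2^{\sqrt{\ell}/\log\ell}$ flows $\phi:E\to\mathbb{Z}_6$ with the property that $\phi(e)\neq f(e)$ for every $e\in E$. Here $\log$ denotes the logarithm to base $2$.
   Context: Graphs are finite and may have loops and parallel edges. A graph is $k$-edge-connected if it has at least two vertices and remains connected after deleting any set of fewer than $k$ edges (for oriented graphs this refers to the underlying undirected graph). For an oriented graph $G=(V,E)$ and $v\in V$, $\delta^+(v)$ is the set of edges with initial vertex $v$ and $\delta^-(v)$ the set of edges with terminal vertex $v$ (a loop at $v$ belongs to both). For an additive abelian group $\Gamma$, a flow is a function $\phi:E\to\Gamma$ with $\sum_{e\in\delta^+(v)}\phi(e)=\sum_{e\in\delta^-(v)}\phi(e)$ for every $v\in V$. *)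

(* Defs.v *)
From mathcomp Require Import all_boot all_order all_algebra.
From mathcomp Require Import reals exp.

Set Implicit Arguments.
Unset Strict Implicit.
Unset Printing Implicit Defensive.

Import GRing.Theory.
Local Open Scope ring_scope.

(* Finite oriented multigraph: loops ([init e = term e]) and parallel edges
   (several [e] with the same ends) are allowed. *)
Record ograph := OGraph {
  vert : finType;
  edge : finType;
  init : edge -> vert;
  term : edge -> vert
}.

Section OrientedGraphs.
Variable G : ograph.

Definition out_edges (v : vert G) : {set edge G} := [set e | init e == v].
Definition in_edges (v : vert G) : {set edge G} := [set e | term e == v].

(* Adjacency in the underlying undirected graph of G - F. *)
Definition adj_del (F : {set edge G}) : rel (vert G) :=
  fun u v => [exists e : edge G, (e \notin F) &&
    ((init e == u) && (term e == v) || (init e == v) && (term e == u))].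

Definition connected_del (F : {set edge G}) : bool :=
  [forall u, forall v, connect (adj_del F) u v].

Definition edge_connected (k : nat) : bool :=
  (1 < #|vert G|)%N &&
  [forall F : {set edge G}, (#|F| < k)%N ==> connected_del F].

Definition is_flow (Gam : zmodType) (phi : edge G -> Gam) : bool :=
  [forall v, \sum_(e in out_edges v) phi e == \sum_(e in in_edges v) phi e].

End OrientedGraphs.

Definition log2 (R : realType) (x : R) : R := ln x / ln 2.

(* Main.v *)
(* Z_6 = Z_2 x Z_3, so one looks for a Z_2-flow phi2 and a Z_3-flow phi3 whose
   agreement sets A2 = {phi2 = f2} and A3 = {phi3 = f3} are disjoint.

   Existence (after Jaeger, Linial, Payan and Tarsi).  Splitting vertices of
   degree at least 4 reduces to the case where all degrees are 3.  There one
   finds an edge set D with connected complement (so that a Z_2-flow can be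
   prescribed on D) such that some Z_3-flow avoids f3 off D.  D is built by
   growing a connected set X, one connected piece L at a time: L has at least
   two edges to X, every vertex of L has an edge to the connected set K of
   remaining vertices, and the edges inside L go to D.

   Counting.  Let l = |E| - |V| and let N be the set of edges outside A2 and A3.
   Fix one solution and let M be the number of all of them.
   - Adding Z_2-flows that vanish on A3 to phi2 gives M >= 2^(l - |A3|).
   - A Z_2-flow chi vanishing on N is the support of a Z_3-flow psi (orient it
     as an Eulerian graph), and (phi2 + chi, phi3 + psi) is again a solution;
     hence M >= 2^(l - |N|).
   - The Z_3-flows psi such that (phi2, phi3 + psi) is a solution are the
     non-zeros of a product of 2|V| + |A2| affine forms on F_3^E which does not
     vanish at 0; hence M^2 >= 3^(2l - |A2|).
   As |A2| + |A3| + |N| = |E| and 3|V| <= 2|E|, these three bounds give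
   M >= 2^(l/4), which is more than required. *)
Require Import Defs.
From mathcomp Require Import all_boot all_order all_algebra.
From mathcomp Require Import ring zify lra.
From mathcomp Require Import reals exp.

Set Implicit Arguments.
Unset Strict Implicit.
Unset Printing Implicit Defensive.

Import GRing.Theory.

(** * Cuts and connectivity *)

Section Graph.
Variables (V E : finType) (s t : E -> V).
Implicit Types (A B C K L Q S U W X : {set V}) (F D : {set E}) (e : E).

Definition joins A B e :=
  (s e \in A) && (t e \in B) || (s e \in B) && (t e \in A).

Definition inside A : {set E} := [set e | (s e \in A) && (t e \in A)].

Definition crosses A e := (s e \in A) (+) (t e \in A).

Definition cut A := (\sum_e crosses A e)%N.

Definition nbr A B := (\sum_e joins A B e)%N.

(** Connectivity of the graph on [S] formed by the edges of [F] inside [S], encoded by cuts instead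
    of paths, so that unions and maximality arguments become case analyses. The empty set counts as
    connected. *)
Definition econn F S :=
  [forall A : {set V}, [&& A \subset S, A != set0 & A != S] ==>
     [exists e in F, joins A (S :\: A) e]].

Lemma econnP F S :
  reflect (forall A, A \subset S -> A != set0 -> A != S ->
             exists2 e, e \in F & joins A (S :\: A) e)
          (econn F S).
Proof.
apply: (iffP forallP) => [H A sA A0 AS|H A].
  by have /implyP/(_ _)/exists_inP := H A; apply; rewrite sA A0.
by apply/implyP => /and3P[sA A0 AS]; apply/exists_inP/H.
Qed.

Lemma joinsC A B e : joins A B e = joins B A e.
Proof. by rewrite /joins orbC. Qed.

Lemma joinsS A B A' B' e :
  A \subset A' -> B \subset B' -> joins A B e -> joins A' B' e.
Proof.
move=> /subsetP sA /subsetP sB; rewrite /joins.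
by case/orP=> /andP[/[dup] h1 h1' /[dup] h2 h2']; apply/orP; [left|right];
  rewrite ?(sA _ h1) ?(sB _ h2) ?(sB _ h1) ?(sA _ h2).
Qed.

Lemma joinsP A B e :
  reflect (exists a b, [/\ a \in A, b \in B & joins [set a] [set b] e])
          (joins A B e).
Proof.
apply: (iffP idP) => [|[a [b [aA bB]]]]; last first.
  by apply: joinsS; rewrite sub1set.
rewrite /joins => /orP[] /andP[h1 h2].
  by exists (s e), (t e); rewrite !inE !eqxx.
by exists (t e), (s e); rewrite !inE !eqxx orbT.
Qed.

Lemma econn1 F v : econn F [set v].
Proof.
apply/econnP => A; rewrite subset1 => /orP[] /eqP-> //.
  by rewrite eqxx.
by rewrite eqxx.
Qed.

(** If [C] splits [A] or [B], that part supplies the edge ([ext]); otherwise [C] contains one of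
    them and misses the other, and [e0] crosses. *)
Lemma econnU F A B :
  econn F A -> econn F B -> (exists2 e, e \in F & joins A B e) ->
  econn F (A :|: B).
Proof.
move=> /econnP cA /econnP cB [e0 e0F je0]; apply/econnP => C sC C0 CAB.
have ext (D : {set V}) : D \subset A :|: B -> C :&: D != set0 -> C :&: D != D ->
    (forall C', C' \subset D -> C' != set0 -> C' != D ->
             exists2 e, e \in F & joins C' (D :\: C') e) ->
    exists2 e, e \in F & joins C ((A :|: B) :\: C) e.
  move=> sD D0 D1 cD; have [|e eF je] := cD (C :&: D) _ D0 D1.
    exact: subsetIr.
  exists e => //; apply: joinsS je; first exact: subsetIl.
  apply/subsetP => x; rewrite !inE => /andP[] /[swap] xD.
  by rewrite xD andbT => ->; have := subsetP sD x xD; rewrite inE.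
have [CA0|CA0] := eqVneq (C :&: A) set0; last first.
  have [CA1|CA1] := eqVneq (C :&: A) A; last first.
    by apply: (ext A) => //; exact: subsetUl.
  have [CB1|CB1] := eqVneq (C :&: B) B.
    case/negP: CAB; rewrite eqEsubset sC /=.
    by rewrite subUset -{1}CA1 -{1}CB1 !subsetIl.
  have [CB0|CB0] := eqVneq (C :&: B) set0; last first.
    by apply: (ext B) => //; exact: subsetUr.
  exists e0 => //; apply: joinsS je0; first by rewrite -CA1 subsetIl.
  apply/subsetP => x xB; rewrite !inE xB orbT andbT.
  by apply/negP => xC; have := in_set0 x; rewrite -CB0 inE xC xB.
have [CB0|CB0] := eqVneq (C :&: B) set0.
  case/negP: C0; rewrite -subset0 -(setIidPl sC).
  by rewrite setIUr CA0 CB0 setU0.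
have [CB1|CB1] := eqVneq (C :&: B) B; last first.
  by apply: (ext B) => //; exact: subsetUr.
exists e0 => //; rewrite joinsC in je0; apply: joinsS je0.
  by rewrite -CB1 subsetIl.
apply/subsetP => x xA; rewrite !inE xA andbT.
by apply/negP => xC; have := in_set0 x; rewrite -CA0 inE xC xA.
Qed.

Lemma econnU1 F A v :
  econn F A -> (exists2 e, e \in F & joins [set v] A e) -> econn F (v |: A).
Proof. by move=> cA; apply: econnU => //; exact: econn1. Qed.

Lemma econn_hang F K L :
  econn F K -> (forall y, y \in L -> exists2 e, e \in F & joins [set y] K e) ->
  econn F (K :|: L).
Proof.
move=> cK; move: {2}#|L| (leqnn #|L|) => m.
elim: m L => [|m IH] L.
  by rewrite leqn0 cards_eq0 => /eqP-> _; rewrite setU0.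
have [->|[y yL]] := set_0Vmem L; first by rewrite setU0.
rewrite (cardsD1 y) yL add1n ltnS => hL hj.
rewrite -(setD1K yL) setUCA; apply: econnU1.
  by apply: IH => // z /setD1P[_]; exact: hj.
have [e eF je] := hj y yL; exists e => //.
by apply: joinsS je => //; exact: subsetUl.
Qed.

Lemma econn_mono F F' S :
  (forall e, e \in F -> e \in inside S -> e \in F') -> econn F S -> econn F' S.
Proof.
move=> sF /econnP cS; apply/econnP => A sA A0 A1.
have [e eF je] := cS A sA A0 A1; exists e => //; apply: sF => //.
move: je; rewrite inE /joins !inE.
by case/orP=> /andP[h1 h2]; [case/andP: h2 => _ ->|case/andP: h1 => _ ->];
  rewrite (subsetP sA) ?andbT.
Qed.

(** [A] is a component of [S], obtained as a maximal connected set: an edge to the rest of [S] would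
    let it grow by a vertex. *)
Lemma econn_comp S Q :
  econn setT Q -> Q \subset S ->
  exists A, [/\ Q \subset A, A \subset S, econn setT A &
                forall e, ~~ joins A (S :\: A) e].
Proof.
move=> cQ sQ.
have h : econn setT Q && (Q \subset S) by rewrite cQ.
have [A /maxsetP[/andP[cA sA] mA] QA] :=
  maxset_exists (P := fun A => econn setT A && (A \subset S)) h.
exists A; split=> // e; apply/negP => /joinsP[a [b [aA]]].
rewrite inE => /andP[bA bS] je.
suff /setP/(_ b) : b |: A = A by rewrite !inE eqxx (negPf bA).
apply: mA; last exact: subsetUr.
rewrite subUset sub1set bS sA !andbT; apply: econnU1 => //.
by exists e; rewrite ?inE // joinsC; apply: joinsS je; rewrite // sub1set.
Qed.

Lemma cut_submod A B : (cut (A :&: B) + cut (A :|: B) <= cut A + cut B)%N.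
Proof.
rewrite /cut -!big_split /=; apply: leq_sum => e _; rewrite /crosses !inE.
by do 4!case: (_ \in _).
Qed.

Lemma cutC A : cut (~: A) = cut A.
Proof.
by apply: eq_bigr => e _; rewrite /crosses !inE; do 2!case: (_ \in _).
Qed.

Lemma nbrS A A' B B' : A \subset A' -> B \subset B' -> (nbr A B <= nbr A' B')%N.
Proof.
move=> sA sB; apply: leq_sum => e _; case h: (joins A B e) => //.
by rewrite (joinsS sA sB h).
Qed.

Lemma nbr_gt0P A B : reflect (exists e, joins A B e) (0 < nbr A B)%N.
Proof.
apply: (iffP idP) => [|[e je]]; last by rewrite /nbr (bigD1 e) //= je.
rewrite lt0n sum_nat_eq0 negb_forall => /existsP[e].
by case h: (joins A B e) => // _; exists e.
Qed.

Lemma nbrU A A' B : [disjoint A & A'] -> [disjoint A :|: A' & B] ->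
  nbr (A :|: A') B = (nbr A B + nbr A' B)%N.
Proof.
rewrite -!setI_eq0 => /eqP/setP d1 /eqP/setP d2; rewrite /nbr -big_split /=.
apply: eq_bigr => e _; rewrite /joins.
have := d1 (s e); have := d1 (t e); have := d2 (s e); have := d2 (t e).
by rewrite !inE; do 6!case: (_ \in _).
Qed.

Lemma cut_nbr A : cut A = nbr A (~: A).
Proof.
by apply: eq_bigr => e _; rewrite /crosses /joins !inE; do 2!case: (_ \in _).
Qed.

End Graph.

(** * Ears in cubic graphs *)

Section Cubic.
Variables (V E : finType) (s t : E -> V).
Implicit Types (A B C K L Q S U W X : {set V}) (F D : {set E}) (e : E).
Local Notation joins := (joins s t).
Local Notation cut := (cut s t).
Local Notation nbr := (nbr s t).
Local Notation conn := (econn s t setT).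
Local Notation inside := (inside s t).
Hypothesis cut3 : forall A, A != set0 -> A != setT -> (2 < cut A)%N.
Hypothesis deg3 : forall v, (cut [set v] <= 3)%N.

Lemma nbrC A B : nbr A B = nbr B A.
Proof. by apply: eq_bigr => e _; rewrite joinsC. Qed.

Lemma connU1 A v : conn A -> (exists e, joins [set v] A e) -> conn (v |: A).
Proof. by move=> cA [e je]; apply: econnU1 => //; exists e; rewrite ?inE. Qed.

Lemma connE S A : conn S -> A \subset S -> A != set0 -> A != S ->
  exists e, joins A (S :\: A) e.
Proof. by move=> /econnP cS sA A0 AS; have [e] := cS A sA A0 AS; exists e. Qed.

(** This starts the maximality argument of [ear]. A maximal connected proper subset [K] of [U]
    misses a single vertex [w]. At least three edges run from [U] to [X], so [K] or [[set w]] has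
    two of them and serves as [W], the other one serving as [K]. *)
Lemma conn_split X : X != set0 -> conn (~: X) -> (1 < #|~: X|)%N ->
  exists K, [&& K \subset ~: X, K != set0, conn K &
    [exists W : {set V}, [&& W \subset ~: X :\: K, conn W & (1 < nbr W X)%N]]].
Proof.
set U := ~: X => X0 cU U2.
have [v vU] : exists v, v \in U by apply/set0Pn; rewrite -card_gt0; apply: ltnW.
pose P K := [&& K \subset U, K != U, conn K & K != set0].
have Pv : P [set v].
  rewrite /P sub1set vU econn1 /=; apply/andP; split.
    by apply: contraTneq U2 => <-; rewrite cards1.
  by apply/set0Pn; exists v; rewrite set11.
have [K /maxsetP[/and4P[KU KU' cK K0] mK] _] := maxset_exists Pv.
have [e /joinsP[a [w [aK]]]] := connE cU KU K0 KU'.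
rewrite inE => /andP[wK wU] je.
have cwK : conn (w |: K).
  apply: connU1 => //; exists e; rewrite joinsC; apply: joinsS je => //.
  by rewrite sub1set.
have wKU : w |: K = U.
  apply/eqP; apply: contraNT wK => h.
  suff <- : w |: K = K by rewrite !inE eqxx.
  apply: mK; last exact: subsetUr.
  rewrite /P cwK h subUset sub1set wU KU /=.
  by apply/set0Pn; exists w; rewrite !inE eqxx.
have dwK : [disjoint [set w] & K] by rewrite disjoints1.
have nU : (2 < nbr [set w] X + nbr K X)%N.
  rewrite -nbrU //; last by rewrite wKU disjoints_subset.
  rewrite wKU -[X in nbr _ X]setCK -cut_nbr; apply: cut3.
    by apply/set0Pn; exists v.
  apply: contraNneq X0 => UT; apply/eqP.
  by rewrite -[X]setCK -/U UT setCT.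
have Uw : U :\: [set w] = K by rewrite -wKU setU1K.
have UK : U :\: K = [set w].
  apply/setP => y; rewrite -wKU !inE.
  by case: eqVneq => [->|_]; rewrite ?wK ?orbF //= andNb.
have [xK|xK] := ltnP 1 (nbr K X).
  exists [set w]; rewrite sub1set wU econn1 /=; apply/andP; split.
    by apply/set0Pn; exists w; rewrite set11.
  by apply/existsP; exists K; rewrite Uw subxx cK xK.
exists K; rewrite KU K0 cK /=; apply/existsP; exists [set w].
rewrite UK subxx econn1 /=; apply: contraLR nU.
by rewrite -!leqNgt => xw; exact: leq_add xw xK.
Qed.

(* Take [K] maximal among the connected sets whose complement in [~: X] still
   contains a connected set with two edges to [X], and let [L] be this complement.
   By maximality, any connected part of [L] with two edges to [X] contains all
   vertices of [L] adjacent to [K]; so a component [Q] of the vertices of [L] not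
   adjacent to [K] has at most two exits (to [X], or to a vertex adjacent to [K]).
   As three edges leave [Q], two of them lead to the same vertex [z], whose third
   edge goes to [K], and then [L :\ z] contradicts the maximality. *)
Lemma ear X : X != set0 -> conn (~: X) -> (1 < #|~: X|)%N ->
  exists L, [/\ L \subset ~: X, ~: X :\: L != set0, conn (~: X :\: L), conn L &
    (1 < nbr L X)%N /\
    forall y, y \in L -> exists e, joins [set y] (~: X :\: L) e].
Proof.
move=> X0 cU U2; have [K0 PK0] := conn_split X0 cU U2.
have [K /maxsetP[/and4P[KU Kn0 cK /existsP[W0 /and3P[W0L cW0 xW0]]] mK] _] :=
  maxset_exists (P := fun K => [&& K \subset ~: X, K != set0, conn K &
    [exists W : {set V}, [&& W \subset ~: X :\: K, conn W & (1 < nbr W X)%N]]]) PK0.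
set U := ~: X in cU U2 KU W0L mK *.
pose L := U :\: K.
have LU : L \subset U by exact: subsetDl.
have UL : U :\: L = K by rewrite /L setDDr setDv set0U; apply/setIidPr.
have dLX A : A \subset L -> [disjoint A & X].
  by move=> AL; rewrite disjoints_subset (subset_trans AL).
pose Z := [set z in L | [exists e, joins [set z] K e]].
have avoid W : W \subset L -> conn W -> (1 < nbr W X)%N -> Z \subset W.
  move=> WL cW xW; apply/subsetP => z; rewrite inE => /andP[zL /existsP[e je]].
  apply: contraLR isT => zW; move: zL; rewrite inE => /andP[zK zU].
  case/negP: zK; suff <- : z |: K = K by rewrite !inE eqxx.
  apply: mK; last exact: subsetUr.
  apply/and4P; split.
  - by rewrite subUset sub1set zU.
  - by apply/set0Pn; exists z; rewrite !inE eqxx.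
  - by apply: connU1 => //; exists e.
  apply/existsP; exists W; rewrite cW xW !andbT.
  apply/subsetP => w wW; have := subsetP WL w wW; rewrite inE => /andP[wK wU].
  rewrite in_setD wU in_setU1 negb_or wK !andbT.
  by apply: contraNneq zW => <-.
(* Vertices of [L] outside the component [W1] of [W0] could reach the rest of [U] only through [K];
   one of them would then lie in [Z], hence in [W1] by [avoid]. *)
have cL : conn L.
  have [W1 [W01 W1L cW1 nW1]] := econn_comp cW0 W0L.
  have xW1 : (1 < nbr W1 X)%N by apply: leq_trans xW0 (nbrS _ _ W01 (subxx _)).
  suff -> : L = W1 by [].
  apply/eqP; rewrite eqEsubset W1L andbT -setD_eq0; apply/negPn/negP => R0.
  have RU : L :\: W1 \subset U by apply: subset_trans (subsetDl _ _) LU.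
  have [|e /joinsP[r [y [rR yR je]]]] := connE cU RU R0.
    apply: contraNneq Kn0 => RU'; apply/eqP/setP => y; rewrite !inE.
    apply/negP => yK; have yU := subsetP KU y yK.
    by move: yU; rewrite -RU' in_setD /L in_setD yK andbF.
  move: yR; rewrite in_setD in_setD negb_and negbK => /andP[/orP[yW|yL] yU].
    case/negP: (nW1 e); rewrite joinsC; apply: joinsS je; first by rewrite sub1set.
    by rewrite sub1set.
  have yK : y \in K by move: yL; rewrite /L in_setD yU andbT negbK.
  have := subsetP (avoid W1 W1L cW1 xW1) r; rewrite inE.
  move: rR; rewrite inE => /andP[/negPf-> ->] /=.
  move=> h; suff: false by []. apply: h; apply/existsP; exists e.
  by apply: joinsS je; rewrite // sub1set.
exists L; rewrite UL; split=> //; split.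
  by apply: leq_trans xW0 (nbrS _ _ W0L (subxx _)).
move=> v vL; apply/existsP; apply: contraT => nv.
have xL : (1 < nbr L X)%N by apply: leq_trans xW0 (nbrS _ _ W0L (subxx _)).
have vLZ : [set v] \subset L :\: Z.
  by rewrite sub1set in_setD vL andbT in_set vL (negPf nv).
have [Q [vQ QLZ cQ nQ]] := econn_comp (econn1 s t setT v) vLZ.
have QL : Q \subset L by apply: subset_trans QLZ (subsetDl _ _).
have Q0 : Q != set0 by apply/set0Pn; exists v; rewrite -sub1set.
have ZL z : z \in Z -> z \in L by rewrite in_set => /andP[].
have exit q y e : q \in Q -> y \notin Q -> joins [set q] [set y] e ->
    (y \in X) || (y \in Z).
  move=> qQ yQ je; apply: contraT; rewrite negb_or => /andP[yX yZ].
  have yU : y \in U by rewrite in_setC.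
  have [yK|yK] := boolP (y \in K).
    have := subsetP QLZ q qQ; rewrite in_setD in_set => /andP[/[swap] ->] /=.
    by move/existsP; case; exists e; apply: joinsS je; rewrite // sub1set.
  case/negP: (nQ e); apply: joinsS je; rewrite sub1set //.
  by rewrite in_setD yQ in_setD yZ /L in_setD yK.
pose N := [set z in Z | [exists e, joins [set z] Q e]].
have [z0 z0N] : exists z, z \in N.
  have [z zZ] : exists z, z \in Z.
    have [||e] := connE cU LU; first by apply/set0Pn; exists v.
      by apply: contraNneq Kn0 => LU'; rewrite -UL LU' setDv.
    rewrite UL => /joinsP[z [k [zL kK je]]]; exists z; rewrite in_set zL.
    by apply/existsP; exists e; apply: joinsS je; rewrite // sub1set.
  have [|e] := connE cL QL Q0.
    apply: contraTneq zZ => QL'; apply/negP => zZ.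
    by have := subsetP QLZ z; rewrite QL' in_setD zZ => /(_ (ZL z zZ)).
  case/joinsP => q [y [qQ]]; rewrite in_setD => /andP[yQ yL] je; exists y.
  have : y \in Z.
    have := exit q y e qQ yQ je => /orP[yX|] //.
    by have := subsetP LU y yL; rewrite in_setC yX.
  move=> yZ; rewrite /N in_set yZ; apply/existsP; exists e.
  by rewrite joinsC; apply: joinsS je; rewrite // sub1set.
have NZ z : z \in N -> z \in Z by rewrite in_set => /andP[].
have NL z : z \in N -> z \in L by move/NZ/ZL.
have QN q z : q \in Q -> z \in Z -> q != z.
  move=> /(subsetP QLZ) + zZ; rewrite in_setD => /andP[qZ _].
  by apply: contraNneq qZ => ->.
(* For [z] in [N], [A z] is the component of [L :\ z] containing [Q]. As it misses [z], [avoid]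
   leaves it at most one edge to [X], so [L :\: A z] has an edge to [X] as well. *)
have /fin_all_exists[A hA] z : exists A, z \in N ->
    [/\ Q \subset A, A \subset L :\ z, conn A & forall e, ~~ joins A (L :\ z :\: A) e].
  have [zN|] := boolP (z \in N); last by exists set0.
  have [|A hA] := econn_comp cQ (_ : Q \subset L :\ z); last by exists A.
  apply/subsetP => q qQ; rewrite in_setD1 (subsetP QL) // andbT.
  by apply: QN => //; exact: NZ.
have clo z w a e : z \in N -> w \in L -> w != z -> a \in A z ->
    joins [set w] [set a] e -> w \in A z.
  move=> zN wL wz aA je; have [_ _ _ /(_ e)] := hA z zN; apply: contraNT => wA.
  rewrite joinsC; apply: joinsS je; rewrite sub1set //.
  by rewrite in_setD wA in_setD1 wz.
have xA z : z \in N -> (nbr (A z) X <= 1)%N.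
  move=> zN; rewrite leqNgt; apply/negP => xAz; have [_ sA cA _] := hA z zN.
  have := avoid _ (subset_trans sA (subD1set _ _)) cA xAz.
  by move/subsetP/(_ z (NZ z zN))/(subsetP sA); rewrite in_setD1 eqxx.
have xarm z : z \in N -> (0 < nbr (L :\: A z) X)%N.
  move=> zN; have [_ sA _ _] := hA z zN.
  have AL : A z \subset L by apply: subset_trans sA (subD1set _ _).
  have := xL; rewrite -{1}(setID L (A z)) (setIidPr AL) nbrU; first last.
  - by apply: dLX; rewrite subUset AL subsetDl.
  - by rewrite disjoint_sym disjoints_subset setDE subsetIr.
  by move/leq_trans => /(_ _ (leq_add (xA z zN) (leqnn _))).
(* The sets [L :\: A z] are pairwise disjoint. Otherwise some edge leads from a vertex of [L]
   outside both [A z] and [A z'] into one of them. By [clo] this vertex is the one removed to form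
   that component; but it is adjacent to [Q], so it lies in the other component. *)
have disj z z' y : z \in N -> z' \in N -> z != z' -> y \in L ->
    (y \in A z) || (y \in A z').
  move=> zN z'N zz' yL; apply: contraT => ny.
  pose B := L :\: (A z :|: A z').
  have BL : B \subset L by exact: subsetDl.
  have [_ /subsetP sA _ _] := hA z zN; have [QA' _ _ _] := hA z' z'N.
  have [QA _ _ _] := hA z zN.
  have [||e] := connE cL BL.
  - by apply/set0Pn; exists y; rewrite in_setD in_setU ny.
  - have /set0Pn[q qQ] := Q0; apply: contraTneq (subsetP QL q qQ) => <-.
    by rewrite in_setD in_setU (subsetP QA).
  have key z1 z2 b a : z1 \in N -> z2 \in N -> z1 != z2 -> b \in L ->
      b \notin A z1 -> b \notin A z2 -> a \in A z1 ->
      joins [set b] [set a] e -> false.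
    move=> h1 h2 h12 bL b1 b2 aA je.
    have [bz|bz] := eqVneq b z1; last by rewrite (clo _ _ _ _ h1 bL bz aA je) in b1.
    case/negP: b2; rewrite bz.
    move: (h1); rewrite in_set => /andP[_ /existsP[e' /joinsP[z3 [q [/set1P-> qQ je']]]]].
    apply: (clo _ _ _ _ h2 (NL _ h1) h12 _ je').
    by have [QA2 _ _ _] := hA z2 h2; rewrite (subsetP QA2).
  case/joinsP => b [a [bB aB je]].
  move: bB; rewrite /B in_setD in_setU negb_or => /andP[/andP[b1 b2] bL].
  move: aB; rewrite in_setD => /andP[+ aL]; rewrite /B in_setD aL andbT negbK in_setU.
  case/orP => [a1|a2]; first exact: (key z z' b a).
  by apply: (key z' z b a); rewrite // eq_sym.
(* If every [z] in [N] had at most one edge to [Q], then [cut Q <= nbr Q X + #|N|]. But [Q] and the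
   sets [L :\: A z] with [z != z0] are disjoint parts of [A z0], which has at most one edge to [X],
   so [nbr Q X + (#|N| - 1) <= 1] and [cut Q <= 2]. *)
have [z zN z2] : exists2 z, z \in N & (1 < nbr Q [set z])%N.
  apply/exists_inP; apply: contraT; rewrite negb_exists_in => /forall_inP hN.
  have [QA0 sA0 _ _] := hA z0 z0N.
  have c1 : (cut Q <= nbr Q X + \sum_(z in N) nbr Q [set z])%N.
    rewrite /nbr exchange_big -big_split /=; apply: leq_sum => e _.
    case ce: (crosses s t Q e) => //.
    have [q [y [qQ yQ je]]] : exists q y, [/\ q \in Q, y \notin Q & joins [set q] [set y] e].
      move: ce; rewrite /crosses; case sQ: (s e \in Q); case tQ: (t e \in Q) => // _.
        by exists (s e), (t e); rewrite sQ tQ /joins !inE !eqxx.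
      by exists (t e), (s e); rewrite sQ tQ /joins !inE !eqxx orbT.
    have [yX|yZ] := orP (exit q y e qQ yQ je).
      by have -> : joins Q X e; [apply: joinsS je; rewrite // sub1set|exact: leq_addr].
    have yN : y \in N.
      rewrite /N in_set yZ; apply/existsP; exists e; rewrite joinsC.
      by apply: joinsS je; rewrite // sub1set.
    rewrite (bigD1 y) //=.
    have -> : joins Q [set y] e by apply: joinsS je; rewrite // sub1set.
    by rewrite addnCA leq_addr.
  have c2 : (nbr Q X + \sum_(z in N | z != z0) nbr (L :\: A z) X <= nbr (A z0) X)%N.
    rewrite /nbr exchange_big -big_split /=; apply: leq_sum => e _.
    have AL z : z \in N -> A z \subset L.
      by move=> zN; have [_ sA _ _] := hA z zN; apply: subset_trans sA (subD1set _ _).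
    have [jL|jL] := boolP (joins L X e); last first.
      rewrite big1 => [|z _]; last first.
        by apply/eqP; rewrite eqb0; apply: contraNN jL; apply: joinsS => //; exact: subsetDl.
      rewrite addn0 (_ : joins Q X e = false) //.
      by apply/negP => j; case/negP: jL; apply: joinsS j.
    have [y yL hS] : exists2 y, y \in L & forall S, S \subset L -> joins S X e = (y \in S).
      have LX w : w \in X -> forall S, S \subset L -> w \in S = false.
        move=> wX S SL; apply/negP => /(subsetP SL)/(subsetP LU).
        by rewrite in_setC wX.
      have XL w : w \in L -> w \in X = false.
        by move/(subsetP LU); rewrite in_setC => /negPf.
      move: jL; rewrite /joins => /orP[] /andP[h1 h2].
        by exists (s e) => // S SL; rewrite h2 (XL _ h1) andbT orbF.
      by exists (t e) => // S SL; rewrite h1 (XL _ h2) andbF.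
    rewrite !hS ?AL // (eq_bigr (fun z => (y \notin A z) : nat)); last first.
      by move=> z _; rewrite hS ?subsetDl // in_setD yL andbT.
    have [yQ|yQ] := boolP (y \in Q).
      rewrite (subsetP QA0) // big1 // => z /andP[zN _].
      by have [QAz _ _ _] := hA z zN; rewrite (subsetP QAz).
    have [/existsP[z1 /and3P[z1N z10 yz1]]|hz] :=
        boolP [exists z, [&& z \in N, z != z0 & y \notin A z]].
      have := disj z1 z0 y z1N z0N z10 yL; rewrite (negPf yz1) /= => ->.
      rewrite (bigD1 z1) ?z1N //= yz1 big1 // => z /andP[/andP[zN _] zz1].
      by have := disj z z1 y zN z1N zz1 yL; rewrite (negPf yz1) orbF => ->.
    rewrite big1 // => z /andP[zN zz0]; apply/eqP; rewrite eqb0 negbK.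
    by apply: contraNT hz => yz; apply/existsP; exists z; rewrite zN zz0.
  have c3 : (#|N|.-1 <= \sum_(z in N | z != z0) nbr (L :\: A z) X)%N.
    rewrite (cardD1 z0) z0N add1n /= -sum1_card.
    rewrite (eq_bigl (fun z => (z \in N) && (z != z0))); last first.
      by move=> z; rewrite !inE andbC.
    by apply: leq_sum => z /andP[zN _]; exact: xarm.
  have c4 : (\sum_(z in N) nbr Q [set z] <= #|N|)%N.
    by rewrite -sum1_card; apply: leq_sum => z /hN; rewrite -leqNgt.
  have N0 : (0 < #|N|)%N by apply/card_gt0P; exists z0.
  have Q3 : (2 < cut Q)%N.
    apply: cut3 => //; apply: contraNneq X0 => QT.
    have LT : L = setT by apply/eqP; rewrite eqEsubset subsetT -QT.
    by have := dLX L (subxx L); rewrite LT -setI_eq0 setTI.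
  have := leq_trans Q3 (leq_trans c1 (leq_add (leqnn _) c4)).
  have := leq_trans (leq_add (leqnn _) c3) (leq_trans c2 (xA z0 z0N)).
  rewrite -ltnS -addnS prednK // => h1 /leq_trans/(_ h1).
  by [].
have zL := NL z zN; have [QA sA _ nA] := hA z zN.
have zK : (0 < nbr [set z] K)%N.
  by apply/nbr_gt0P; move: (NZ z zN); rewrite in_set => /andP[_ /existsP].
pose R := ~: (z |: (Q :|: K)).
(* Two edges to [Q] and one to [K] exhaust the degree of [z]. Hence [A z] is all of [L :\ z], with
   at most one edge to [X], and another edge from [L] to [X] would have to start at [z], although
   [X] lies in [R]. *)
have noR e : ~~ joins [set z] R e.
  have le3 : (nbr [set z] Q + nbr [set z] K + nbr [set z] R <= cut [set z])%N.
    rewrite /nbr -!big_split /=; apply: leq_sum => e' _.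
    have zQ : z \notin Q by apply/negP => /(QN z z)/(_ (NZ z zN)); rewrite eqxx.
    have zK' : z \notin K by move: zL; rewrite in_setD => /andP[].
    have fQ w : w \in Q -> w \in K = false.
      by move/(subsetP QL); rewrite in_setD => /andP[/negPf].
    have := fQ (s e'); have := fQ (t e').
    rewrite /joins /crosses /R !in_setC !in_setU !in_set1.
    case: eqVneq => [->|_]; case: eqVneq => [->|_];
      rewrite ?(negPf zQ) ?(negPf zK') //=;
      do ![case: (_ \in _) => //=]; move=> h1 h2;
      by first [move: (h1 isT) | move: (h2 isT)].
  apply: contraT; rewrite negbK => je.
  have R1 : (0 < nbr [set z] R)%N by apply/nbr_gt0P; exists e.
  rewrite nbrC in z2.
  have := leq_trans (leq_add (leq_add z2 zK) R1) (leq_trans le3 (deg3 z)).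
  by [].
have LA : L :\ z \subset A z.
  rewrite -setD_eq0; apply: contraT => R0.
  have RL : L :\ z :\: A z \subset L by apply: subset_trans (subsetDl _ _) (subD1set _ _).
  have [|e] := connE cL RL R0.
    by apply: contraTneq zL => <-; rewrite !inE eqxx andbF.
  case/joinsP => r [y [rR yR je]].
  move: (rR); rewrite in_setD in_setD1 => /and3P[rA rz rL].
  have [yz|yz] := eqVneq y z.
    case/negP: (noR e); rewrite joinsC -yz; apply: joinsS je => //.
    rewrite sub1set /R in_setC in_setU1 (negPf rz) /= in_setU negb_or.
    by rewrite (contraNN (subsetP QA r) rA); move: rL; rewrite /L in_setD => /andP[].
  case/negP: (nA e); rewrite joinsC; apply: joinsS je; rewrite sub1set //.
  move: yR; rewrite in_setD => /andP[+ yL]; rewrite in_setD in_setD1 yz yL !andbT.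
  by rewrite negbK.
have [e je] : exists e, joins [set z] X e.
  apply/nbr_gt0P; have := xL; rewrite -(setD1K zL) nbrU; first last.
  - by rewrite setD1K //; exact: dLX.
  - by rewrite disjoints1 in_setD1 eqxx.
  rewrite -[(1 < _)%N]ltnS -addSn => /leq_trans.
  move/(_ _ (leq_add (leqnn _) (leq_trans (nbrS s t LA (subxx X)) (xA z zN)))).
  by rewrite addn1.
case/negP: (noR e); apply: joinsS je => //.
apply/subsetP => x xX; rewrite /R in_setC in_setU1 in_setU !negb_or.
have nL y : y \in L -> x != y.
  by move=> /(subsetP LU); rewrite in_setC; apply: contraNneq => <-.
rewrite nL //=; apply/andP; split.
  by apply/negP => xQ; have := nL x (subsetP QL x xQ); rewrite eqxx.
by apply/negP => /(subsetP KU); rewrite in_setC xX.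
Qed.
End Cubic.

Local Open Scope ring_scope.

(** * Flows *)

Section Boundary.
Variables (V E : finType) (s t : E -> V) (Gam : zmodType).
Implicit Types (g h : E -> Gam) (v w : V) (e : E) (F D : {set E}) (A B S : {set V}).

Definition bd g v := \sum_(e | s e == v) g e - \sum_(e | t e == v) g e.

Definition flow g := forall v, bd g v = 0.

Definition single e a : E -> Gam := fun x => if x == e then a else 0.

Lemma eq_bd g h v : g =1 h -> bd g v = bd h v.
Proof. by move=> gh; rewrite /bd; congr (_ - _); apply: eq_bigr. Qed.

Lemma bd0 v : bd (fun=> 0) v = 0.
Proof. by rewrite /bd !big1 // subr0. Qed.

Lemma bdD g h v : bd (fun e => g e + h e) v = bd g v + bd h v.
Proof. by rewrite /bd !big_split /= opprD addrACA. Qed.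

Lemma bdN g v : bd (fun e => - g e) v = - bd g v.
Proof. by rewrite /bd !sumrN opprB opprK addrC. Qed.

Lemma bdB g h v : bd (fun e => g e - h e) v = bd g v - bd h v.
Proof. by rewrite bdD bdN. Qed.

Lemma bd_sum (I : Type) (r : seq I) (P : pred I) (g : I -> E -> Gam) v :
  bd (fun e => \sum_(i <- r | P i) g i e) v = \sum_(i <- r | P i) bd (g i) v.
Proof.
rewrite /bd sumrB; congr (_ - _); exact: exchange_big.
Qed.

Lemma bd_single e a v : bd (single e a) v = a *+ (s e == v) - a *+ (t e == v).
Proof.
have h (p : pred E) : \sum_(x | p x) single e a x = a *+ p e.
  rewrite /single -big_mkcondr /=; case pe: (p e).
    rewrite (big_pred1 e) // => x /=.
    by case: eqVneq => [->|_]; rewrite ?pe ?andbF ?eqxx ?andbT.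
  rewrite big1 // => x /andP[px /eqP xe].
  by rewrite xe pe in px.
by rewrite /bd !h.
Qed.

Lemma flowD g h : flow g -> flow h -> flow (fun e => g e + h e).
Proof. by move=> fg fh v; rewrite bdD fg fh addr0. Qed.

(** The value [a] is sent from [u] to [v]. The set of vertices that can be reached in this way grows
    by one vertex at a time until it fills [S]. *)
Lemma route F S u v a : econn s t F S -> u \in S -> v \in S ->
  exists g, (forall e, e \notin F :&: inside s t S -> g e = 0) /\
            forall w, bd g w = a *+ (u == w) - a *+ (v == w).
Proof.
move=> /econnP cS uS vS.
pose reach v := exists g, (forall e, e \notin F :&: inside s t S -> g e = 0) /\
            forall w, bd g w = a *+ (u == w) - a *+ (v == w).
suff [R [RS mR hR]] : exists R : {set V},
    [/\ R \subset S, (#|S| <= #|R|)%N & forall v, v \in R -> reach v].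
  apply: hR; suff -> : R = S by [].
  by apply/eqP; rewrite eqEcard RS.
suff /(_ _ (leqnn _)) [R [_ ? ? ?]] : forall m, (m <= #|S|)%N ->
    exists R : {set V}, [/\ u \in R, R \subset S, (m <= #|R|)%N
      & forall v, v \in R -> reach v] by exists R.
elim=> [_|m IH mS].
  exists [set u]; rewrite set11 sub1set; split=> // x /set1P->.
  by exists (fun=> 0); split=> // w; rewrite bd0 subrr.
have [R [uR RS mR hR]] := IH (ltnW mS).
have [RS'|RS'] := eqVneq R S; first by exists R; split=> //; rewrite RS'.
have [|e eF] := cS R RS _ RS'; first by apply/set0Pn; exists u.
case/joinsP => x [y [xR]]; rewrite inE => /andP[yR yS].
move=> je.
have xS : x \in S by apply: (subsetP RS).
have [g [g0 bg]] := hR x xR.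
have eI : e \in F :&: inside s t S.
  rewrite !inE eF /=; move: je; rewrite /joins !inE.
  by case/orP=> /andP[/eqP-> /eqP->]; rewrite xS yS.
have ry : reach y.
  move: je; rewrite /joins !inE => /orP[] /andP[/eqP sE /eqP tE].
    exists (fun e' => g e' + single e a e'); split=> [e' he'|w].
      rewrite g0 // /single; case: eqVneq => [ee|]; last by rewrite addr0.
      by rewrite ee eI in he'.
    by rewrite bdD bg bd_single sE tE addrA subrK.
  exists (fun e' => g e' - single e a e'); split=> [e' he'|w].
    rewrite g0 // /single; case: eqVneq => [ee|]; last by rewrite subr0.
    by rewrite ee eI in he'.
  by rewrite bdB bg bd_single sE tE opprB addrA subrK.
exists (y |: R); rewrite cardsU1 yR add1n ltnS mR !inE uR orbT.
rewrite subUset sub1set yS RS; split=> // z.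
by rewrite !inE => /orP[/eqP->|/hR].
Qed.

(** A return route off [D] closes each edge of [D] to a cycle, and the sum of these cycles has the
    prescribed values on [D]. *)
Lemma cotree_flow D h : econn s t (~: D) setT ->
  exists g, flow g /\ forall e, e \in D -> g e = h e.
Proof.
move=> cD.
have /fin_all_exists[r hr] e := route (h e) cD (in_setT (t e)) (in_setT (s e)).
exists (fun x => \sum_(e in D) (single e (h e) x + r e x)); split.
  move=> v; rewrite (bd_sum _ _ (fun e x => single e (h e) x + r e x)) big1 //.
  move=> e _; rewrite bdD bd_single (hr e).2 addrA subrK subrr //.
move=> e eD; rewrite (bigD1 e) //= /single eqxx (hr e).1 ?inE ?eD //.
rewrite addr0 big1 ?addr0 // => x /andP[xD xe].
by rewrite eq_sym (negPf xe) add0r (hr x).1 // !inE eD.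
Qed.

Lemma joins_notin A B e : [disjoint A & B] -> joins s t A B e ->
  e \notin inside s t A /\ e \notin inside s t B.
Proof.
rewrite -setI_eq0 => /eqP/setP d; have := d (s e); have := d (t e).
by rewrite /joins !inE; do 4!case: (_ \in _).
Qed.

Lemma arc A B b a : joins s t A B b ->
  exists x y g, [/\ x \in A, y \in B, forall e, e != b -> g e = 0,
    g b = a \/ g b = - a & forall w, bd g w = a *+ (x == w) - a *+ (y == w)].
Proof.
case/orP=> /andP[sb tb].
  exists (s b), (t b), (single b a); rewrite /single eqxx; split; auto.
    by move=> e /negPf->.
  by move=> w; rewrite bd_single.
exists (t b), (s b), (single b (- a)); rewrite /single eqxx; split; auto.
  by move=> e /negPf->.
by move=> w; rewrite bd_single !mulNrn opprK addrC.
Qed.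

(** The cycle crosses along [b], comes back along [b'] and is closed by routes inside [A] and [B]. A
    global sign makes its value on [b] equal to [a]; the sign on [b'] depends on the
    orientations. *)
Lemma cycle_flow A B b b' a :
  [disjoint A & B] -> econn s t setT A -> econn s t setT B ->
  b != b' -> joins s t A B b -> joins s t A B b' ->
  exists c, [/\ flow c, c b = a, c b' = a \/ c b' = - a &
    forall e, e != b -> e != b' -> e \notin inside s t A ->
      e \notin inside s t B -> c e = 0].
Proof.
move=> dAB cA cB bb' jb jb'.
have notin e := @joins_notin A B e dAB.
have [x [y [g [xA yB g0 gb bg]]]] := arc a jb.
have [x' [y' [g' [xA' yB' g0' gb' bg']]]] := arc a jb'.
have [p [p0 bp]] := route a cA xA' xA.
have [q [q0 bq]] := route a cB yB yB'.
pose c e := g e - g' e + (p e + q e).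
have id4 (X Y X' Y' : Gam) : X - Y - (X' - Y') + (X' - X + (Y - Y')) = 0.
  rewrite (addrACA X') (addrC X' Y) -(addrACA Y) -(opprB X Y).
  by rewrite addrACA subrr addNr addr0.
have fc : flow c by move=> w; rewrite /c !bdD bdN bg bg' bp bq id4.
have [bA bB] := notin _ jb; have [bA' bB'] := notin _ jb'.
have notF (S : {set V}) e : e \notin inside s t S -> e \notin setT :&: inside s t S.
  by move=> h; rewrite in_setI negb_and h orbT.
have cb : c b = g b by rewrite /c g0' // p0 ?q0 ?notF // subr0 !addr0.
have cb' : c b' = - g' b'.
  by rewrite /c g0 1?eq_sym // p0 ?q0 ?notF // sub0r !addr0.
have c0 e : e != b -> e != b' -> e \notin inside s t A ->
    e \notin inside s t B -> c e = 0.
  by move=> h1 h2 h3 h4; rewrite /c g0 // g0' // p0 ?q0 ?notF // subr0 !addr0.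
case: gb => gb.
  exists c; split=> //; first by rewrite cb.
  by rewrite cb'; case: gb' => ->; rewrite ?opprK; auto.
exists (fun e => - c e); split; first by move=> w; rewrite bdN fc oppr0.
- by rewrite cb gb opprK.
- by rewrite cb' opprK; case: gb' => ->; auto.
by move=> e h1 h2 h3 h4; rewrite c0 ?oppr0.
Qed.

End Boundary.

Lemma F3_avoid2 (u v : 'F_3) : exists a, a != u /\ (a != v).
Proof.
have /existsP[a /andP[]] : [exists a : 'F_3, (a != u) && (a != v)].
  by move: u v; do 2!case=> [[|[|[|//]]] ?]; apply/existsP;
   first [by exists 0 | by exists 1 | by exists (1 + 1)].
by exists a.
Qed.

Lemma bdZ (V E : finType) (s t : E -> V) (R : pzRingType) (a : R) (g : E -> R) v :
  bd s t (fun e => a * g e) v = a * bd s t g v.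
Proof. by rewrite /bd mulrBr !mulr_sumr. Qed.

(** * Correcting a Z_3-flow on the edges between two connected sets *)

Section EarStep.
Variables (V E : finType) (s t : E -> V).

(** Two joining edges [b], [b'] are kept in reserve. Each other joining edge is corrected by a cycle
    through it and [b']; finally a multiple of one cycle through [b] and [b'] corrects both, since
    F_3 has an element besides two forbidden ones. *)
Lemma ear_step (A B : {set V}) (f phi : E -> 'F_3) :
  [disjoint A & B] -> econn s t setT A -> econn s t setT B ->
  (1 < nbr s t A B)%N -> flow s t phi ->
  exists psi, [/\ flow s t psi, forall e, joins s t A B e -> psi e != f e &
    forall e, ~~ joins s t A B e -> e \notin inside s t A ->
      e \notin inside s t B -> psi e = phi e].
Proof.
move=> dAB cA cB n2 fphi.
have [b [b' [bb' jb jb']]] : exists b b', [/\ b != b', joins s t A B b & joins s t A B b'].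
  have /card_gt1P[b [b' [jb jb' bb']]] : (1 < #|[set e | joins s t A B e]|)%N.
    suff <- : nbr s t A B = #|[set e | joins s t A B e]| by [].
    rewrite -sum1_card [RHS]big_mkcond; apply: eq_bigr => e _.
    by rewrite inE; case: (joins _ _ _ _ _).
  by exists b, b'; move: jb jb'; rewrite !inE.
pose out e := [&& ~~ joins s t A B e, e \notin inside s t A & e \notin inside s t B].
have hs (r : seq E) : b \notin r -> b' \notin r -> all (joins s t A B) r ->
  exists psi, [/\ flow s t psi, forall e, e \in r -> psi e != f e &
    forall e, out e -> psi e = phi e].
  elim: r => [_ _ _|e r IH]; first by exists phi.
  rewrite !inE !negb_or /= => /andP[be br] /andP[be' br'] /andP[je jr].
  have [psi [fpsi hpsi opsi]] := IH br br' jr.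
  have [er|er] := boolP (e \in r).
    by exists psi; split=> // x; rewrite inE => /orP[/eqP->|]; exact: hpsi.
  have [a [ha _]] := F3_avoid2 (f e - psi e) 0.
  have eb : e != b' by rewrite eq_sym.
  have [c [fc ce _ c0]] := cycle_flow a dAB cA cB eb je jb'.
  exists (fun x => psi x + c x); split; first exact: flowD.
    move=> x; rewrite inE => /orP[/eqP->|xr].
      by apply: contraNneq ha => <-; rewrite ce addrC addKr.
    have [xA xB] := joins_notin dAB (allP jr _ xr).
    rewrite c0 ?addr0 ?hpsi //; first by apply: contraNneq er => <-.
    by apply: contraNneq br' => <-.
  move=> x /[dup] ox /and3P[jx xA xB]; rewrite c0 ?addr0 ?opsi //.
    by apply: contraNneq jx => ->.
  by apply: contraNneq jx => ->.
have [||| psi [fpsi hpsi opsi]] :=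
  hs [seq e <- enum E | [&& joins s t A B e, e != b & e != b']].
- by rewrite mem_filter eqxx andbF.
- by rewrite mem_filter eqxx !andbF.
- by apply/allP => e; rewrite mem_filter => /andP[/and3P[]].
have [c [fc cb cb' c0]] := cycle_flow (1 : 'F_3) dAB cA cB bb' jb jb'.
(* These are the multipliers for which [psi + a * c] would meet [f] at [b], where [c] is 1, and at
   [b']. *)
have [a [ha ha']] := F3_avoid2 (f b - psi b) ((f b' - psi b') / c b').
have cb'0 : c b' != 0 by case: cb' => ->; rewrite ?oppr_eq0 oner_eq0.
exists (fun e => psi e + a * c e); split.
- by apply: flowD => // v; rewrite bdZ fc mulr0.
- move=> e je; have [->|eb] := eqVneq e b.
    by apply: contraNneq ha => <-; rewrite cb mulr1 addrC addKr.
  have [->|eb'] := eqVneq e b'.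
    by apply: contraNneq ha' => <-; rewrite [psi b' + _]addrC addrK mulfK.
  have [eA eB] := joins_notin dAB je.
  by rewrite c0 // mulr0 addr0 hpsi // mem_filter mem_enum je eb eb'.
move=> e je eA eB; rewrite c0 //; last first.
- by apply: contraNneq je => ->.
- by apply: contraNneq je => ->.
by rewrite mulr0 addr0 opsi // /out je eA.
Qed.

End EarStep.

(** * Existence of one solution *)

Section CubicExistence.
Variables (V E : finType) (s t : E -> V).
Implicit Types (A B C K L Q S U W X : {set V}) (F D : {set E}) (e : E).
Local Notation joins := (joins s t).
Local Notation cut := (cut s t).
Local Notation nbr := (nbr s t).
Local Notation conn := (econn s t setT).
Local Notation inside := (inside s t).
Hypothesis cut3 : forall A, A != set0 -> A != setT -> (2 < cut A)%N.
Hypothesis deg3 : forall v, (cut [set v] <= 3)%N.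

(** Induction along an ear decomposition; [D] collects the edges inside the ears. The flow is
    corrected in reverse order: first the flow for [X :|: L] is taken, then the edges between [X]
    and [L] are corrected, which disturbs only edges inside [X] or [L], where nothing is
    required. *)
Lemma ears X : X != set0 -> ~: X != set0 -> conn X -> conn (~: X) ->
  exists D : {set E}, [/\ D \subset inside (~: X), econn s t (~: D) (~: X) &
    forall f : E -> 'F_3, exists psi, flow s t psi /\
      forall e, e \notin D -> e \notin inside X -> psi e != f e].
Proof.
move: {2}#|~: X| (leqnn #|~: X|) => m.
elim: m X => [X|m IH X hm X0 U0 cX cU].
  by rewrite leqn0 cards_eq0 => /eqP->; rewrite eqxx.
have other (L : {set V}) e : X \subset ~: L -> X :|: L = setT -> e \notin inside L ->
    e \notin inside X -> joins X L e.
  move=> /subsetP dXL /setP XL.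
  have := XL (s e); have := XL (t e).
  by rewrite !inE /joins; do 4!case: (_ \in _).
have [U1|U2] := leqP #|~: X| 1.
  have [y yU] : exists y, ~: X = [set y].
    by apply/cards1P; rewrite eqn_leq U1 card_gt0.
  (* The last ear is a single vertex, and [D] consists of its loops. *)
  exists (inside (~: X)); split=> //.
    by rewrite yU econn1.
  move=> f; have [|||psi [fpsi hpsi _]] :=
      @ear_step V E s t X (~: X) f (fun=> 0) _ cX cU.
  - by rewrite disjoints_subset setCK.
  - rewrite nbrC -{2}[X]setCK -cut_nbr ltnW // cut3 //.
    by apply: contraNneq X0 => UT; rewrite -[X]setCK UT setCT.
  - by move=> v; rewrite bd0.
  exists psi; split=> // e eU eX; apply: hpsi; apply: other => //.
    by rewrite setCK.
  by rewrite setUCr.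
have [L [LU K0 cK cL [xL hL]]] := ear cut3 deg3 X0 cU U2.
set K := ~: X :\: L in K0 cK hL.
have dXL : X \subset ~: L by rewrite -disjoints_subset disjoint_sym disjoints_subset.
have XLK : ~: (X :|: L) = K by rewrite /K setCU setDE.
have cXL : conn (X :|: L).
  apply: econnU => //; rewrite nbrC in xL.
  by have /nbr_gt0P[e je] := ltnW xL; exists e; rewrite ?inE.
have L0 : L != set0.
  apply: contraTneq xL => ->; rewrite /nbr big1 // => e _.
  by rewrite /joins !inE andbF.
have [|||||D [DK cD hD]] := IH (X :|: L); rewrite ?XLK //.
- rewrite -ltnS; apply: leq_trans hm; apply: proper_card; rewrite /K.
  rewrite properE subsetDl /=; have /set0Pn[y yL] := L0.
  by apply/subsetPn; exists y; rewrite ?(subsetP LU) // in_setD yL.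
- by apply: contraNneq X0 => h; rewrite -subset0 -h subsetUl.
rewrite XLK in DK cD.
have UKL : ~: X = K :|: L.
  apply/setP => y; rewrite in_setU /K in_setD; have := subsetP LU y.
  by case: (y \in L) => [->|_] //=; rewrite orbF.
have KL y : y \in K -> y \in L = false by rewrite in_setD => /andP[/negPf].
have KU : K \subset ~: X by exact: subsetDl.
exists (D :|: inside L); split.
- rewrite subUset; apply/andP; split.
    apply: subset_trans DK _; apply/subsetP => e.
    by rewrite [e \in inside K]in_set => /andP[h1 h2]; rewrite in_set !(subsetP KU).
  apply/subsetP => e; rewrite [e \in inside L]in_set => /andP[h1 h2].
  by rewrite in_set !(subsetP LU).
- rewrite UKL; apply: econn_hang.
    apply: econn_mono cD => e; rewrite !in_setC in_setU => eD.
    by rewrite [e \in inside K]in_set => /andP[/KL h _]; rewrite (negPf eD) in_set h.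
  move=> y yL; have [e je] := hL y yL; exists e => //.
  have [||eL eK] := @joins_notin _ _ s t L K e.
  - by rewrite disjoint_sym disjoints_subset /K setDE subsetIr.
  - by apply: joinsS je; rewrite // sub1set.
  rewrite in_setC in_setU negb_or eL andbT.
  by apply: contraNN eK; apply: subsetP.
move=> f; have [psi [fpsi hpsi]] := hD f.
have dXL' : [disjoint X & L] by rewrite disjoints_subset.
rewrite nbrC in xL.
have [psi' [fpsi' hj ho]] := ear_step f dXL' cX cL xL fpsi.
exists psi'; split=> // e; rewrite in_setU negb_or => /andP[eD eL] eX.
have [/hj//|ej] := boolP (joins X L e).
rewrite ho //; apply: hpsi => //; move: eX eL ej.
by rewrite /joins !inE; do 4!case: (_ \in _).
Qed.

Lemma cubic_existence (f2 : E -> 'F_2) (f3 : E -> 'F_3) : (1 < #|V|)%N ->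
  exists phi2 phi3, [/\ flow s t phi2, flow s t phi3 &
    forall e, (phi2 e != f2 e) || (phi3 e != f3 e)].
Proof.
move=> V2; have [r _] : exists r : V, r \in V by apply/card_gt0P/ltnW.
have r0 : [set r] != set0 by apply/set0Pn; exists r; rewrite set11.
have CrT A : A != set0 -> A \subset ~: [set r] -> (2 < cut A)%N.
  move=> A0 Ar; apply: cut3 => //; apply: contraTneq Ar => ->.
  by apply/subsetPn; exists r; rewrite !inE ?eqxx.
have U0 : ~: [set r] != set0.
  by rewrite -card_gt0 cardsCs setCK cards1 subn_gt0.
(* Two parts without a joining edge would each send at least three edges to [r], whose degree is at
   most three. *)
have cU : conn (~: [set r]).
  apply/econnP => A Ar A0 AU.
  apply/exists_inP; apply: contraT; rewrite negb_exists_in => /forall_inP hA.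
  pose B := ~: [set r] :\: A.
  have B0 : B != set0.
    by apply: contraNneq AU => /eqP; rewrite setD_eq0 eqEsubset Ar => ->.
  have := leq_trans (leq_add (CrT A A0 Ar) (CrT B B0 (subsetDl _ _)))
    (_ : _ <= cut [set r])%N.
  move/(_ _)/leq_trans/(_ (deg3 r)); apply.
  rewrite /cut -big_split /=; apply: leq_sum => e _.
  have := hA e; rewrite in_setT => /(_ isT); rewrite /joins /crosses /B.
  have := subsetP Ar (s e); have := subsetP Ar (t e).
  rewrite !in_setD !in_setC !in_set1.
  by do 2!case: (_ \in A); case: (_ == _); case: (_ == _) => // h1 h2;
    first [move: (h1 isT) | move: (h2 isT) | move=> _].
have [D [DU cD hD]] := ears r0 U0 (econn1 _ _ _ _) cU.
have [psi [fpsi hpsi]] := hD f3.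
pose D' := D :|: inside [set r].
have cD' : econn s t (~: D') setT.
  rewrite -(setUCr [set r]) setUC; apply: econn_hang.
    apply: econn_mono cD => e; rewrite !in_setC in_setU => eD.
    by rewrite [e \in inside _]in_set !in_setC => /andP[h1 h2];
      rewrite (negPf eD) in_set (negPf h1).
  move=> y /set1P->.
  have : (0 < nbr [set r] (~: [set r]))%N.
    rewrite -cut_nbr; apply: ltn_trans (cut3 r0 _) => //.
    by apply: contraNneq U0 => ->; rewrite setCT.
  case/nbr_gt0P => e je; exists e => //.
  have [|e1 e2] := joins_notin _ je; first by rewrite disjoints_subset setCK.
  rewrite in_setC in_setU negb_or e1 andbT.
  by apply: contraNN e2; apply: subsetP.
(* As [f2 e + 1] differs from [f2 e], the Z_2-flow takes care of [D'], and [psi] of the other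
   edges. *)
have [g [fg hg]] := cotree_flow (fun e => f2 e + 1) cD'.
exists g, psi; split=> // e.
have [eD|] := boolP (e \in D'); last first.
  by rewrite in_setU negb_or => /andP[e1 e2]; rewrite hpsi ?orbT.
by rewrite hg // -subr_eq0 addrC addKr oner_eq0.
Qed.

End CubicExistence.

Lemma big_option (R : Type) (idx : R) (op : Monoid.com_law idx) (T : finType)
    (F : option T -> R) :
  \big[op/idx]_x F x = op (F None) (\big[op/idx]_x F (Some x)).
Proof.
rewrite (bigD1 None) //=; congr (op _ _).
by rewrite (reindex_omap Some id) => [|[x|] //]; apply: eq_bigl => x; rewrite eqxx.
Qed.

(** * Splitting vertices of degree at least four *)

Section Splitting.
Variables (V E : finType) (s t : E -> V).
Implicit Types (A B : {set V}) (e : E).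
Hypothesis cut3 : forall A, A != set0 -> A != setT -> (2 < cut s t A)%N.

(** Call [B] tight if [v] is outside, its cut is at most 3 and [e] leads from [v] into it. As [v]
    has degree at least 4, some edge [e'] at [v] avoids a maximal tight [B]. If a tight [B']
    received both edges, submodularity would make [B :|: B'] tight, hence equal to [B], and [e']
    would lead into [B]. *)
Lemma split_pair v : (3 < cut s t [set v])%N ->
  exists e e', [/\ e != e', crosses s t [set v] e, crosses s t [set v] e' &
    forall B, v \notin B -> joins s t [set v] B e -> joins s t [set v] B e' ->
      (3 < cut s t B)%N].
Proof.
move=> v4.
have nT B : v \notin B -> B != setT by apply: contraNneq => ->; rewrite inE.
have [e ce] : exists e, crosses s t [set v] e.
  apply/existsP; apply: contraTT v4; rewrite negb_exists => /forallP h.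
  by rewrite /cut big1 // => e _; rewrite (negPf (h e)).
pose P B := [&& v \notin B, cut s t B <= 3 & joins s t [set v] B e]%N.
have lt_nbr B : v \notin B -> (cut s t B <= 3)%N ->
    exists2 e', crosses s t [set v] e' & ~~ joins s t [set v] B e'.
  move=> vB B3; apply/exists_inP; apply: contraLR v4.
  rewrite negb_exists_in => /forall_inP h; rewrite -leqNgt.
  apply: leq_trans B3; apply: leq_sum => x _; case cx: (crosses _ _ _ x) => //.
  have := h x cx; rewrite negbK; move: cx; rewrite /crosses /joins !in_set1.
  case: eqVneq => [->|_]; case: eqVneq => [->|_] //= _.
    by rewrite andbF orbF (negPf vB) => ->.
  by rewrite andbT (negPf vB) => ->.
have [/existsP[B0 PB0]|nP] := boolP [exists B, P B]; last first.
  have [e' ce' ee'] : exists2 e', crosses s t [set v] e' & e' != e.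
    apply/exists_inP; apply: contraLR v4; rewrite negb_exists_in => /forall_inP h.
    rewrite -leqNgt /cut (bigD1 e) //= big1 ?addn0 ?(leq_trans (leq_b1 _)) // => x xe.
    by apply/eqP; rewrite eqb0; apply: contraNN xe => /h; rewrite negbK.
  exists e, e'; split=> //; first by rewrite eq_sym.
  move=> B vB jB _; rewrite ltnNge; apply: contraNN nP => B3.
  by apply/existsP; exists B; rewrite /P vB B3.
have [B /maxsetP[/and3P[vB B3 jB] mB] _] := maxset_exists PB0.
have [e' ce' je'] := lt_nbr B vB B3.
exists e, e'; split=> //; first by apply: contraNneq je' => <-.
move=> B' vB' jB' jB'e'; rewrite ltnNge; apply/negP => B'3.
have I0 : B :&: B' != set0.
  move: jB jB'; rewrite /joins !in_set1 => jB jB'; apply/set0Pn.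
  have ex x : x \in B -> x \in B' -> exists x, x \in B :&: B'.
    by move=> h1 h2; exists x; rewrite inE h1.
  case/orP: jB => /andP[h1 h2]; case/orP: jB' => /andP[h3 h4].
  - exact: ex h2 h4.
  - by move: vB; rewrite -(eqP h4) h2.
  - by move: vB; rewrite -(eqP h3) h1.
  - exact: ex h1 h3.
have vU : v \notin B :|: B' by rewrite inE negb_or vB.
have U0 : B :|: B' != set0.
  by apply: contraNneq I0 => h; rewrite -subset0 -h; apply: subset_trans (subsetIl _ _) (subsetUl _ _).
have vI : v \notin B :&: B' by rewrite inE negb_and vB.
have U3 : (cut s t (B :|: B') <= 3)%N.
  rewrite -(leq_add2l 3); apply: leq_trans (leq_add B3 B'3).
  apply: leq_trans (cut_submod s t B B'); rewrite leq_add2r.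
  by apply: cut3 => //; exact: nT.
have UB : B :|: B' = B.
  apply: mB; last exact: subsetUl.
  by rewrite /P vU U3 (joinsS _ _ jB) // subsetUl.
case/negP: je'; apply: joinsS jB'e' => //.
by rewrite -UB subsetUr.
Qed.

Section Split.
Variables (v : V) (e e' : E).
Hypothesis ee' : e != e'.
Hypothesis ce : crosses s t [set v] e.
Hypothesis ce' : crosses s t [set v] e'.
Hypothesis loose : forall B, v \notin B -> joins s t [set v] B e ->
  joins s t [set v] B e' -> (3 < cut s t B)%N.

(* The ends at [v] of [e] and [e'] are moved to a new vertex [None], which a new
   edge [None] joins to [v]. *)
Definition split_end (x : V) (y : E) : option V :=
  if (y \in [set e; e']) && (x == v) then None else Some x.
Definition split_s (y : option E) : option V :=
  if y is Some y then split_end (s y) y else Some v.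
Definition split_t (y : option E) : option V :=
  if y is Some y then split_end (t y) y else None.

Definition other_end (y : E) := if s y == v then t y else s y.

(** Only [e], [e'] and the new edge change their contribution; the balance is written without
    subtraction. *)
Lemma cut_split (A : {set option V}) (B := [set x | Some x \in A]) :
  (cut split_s split_t A + ((v \in B) (+) (other_end e \in B)) +
     ((v \in B) (+) (other_end e' \in B)) =
   cut s t B + ((v \in B) (+) (None \in A)) +
     ((None \in A) (+) (other_end e \in B)) +
     ((None \in A) (+) (other_end e' \in B)))%N.
Proof.
rewrite /cut big_option (bigD1 e) // (bigD1 e') 1?eq_sym //=.
rewrite [in RHS](bigD1 e) // [in RHS](bigD1 e') 1?eq_sym //=.
rewrite (eq_bigr (fun x => crosses s t B x : nat)); last first.
  move=> x /andP[/negPf h1 /negPf h2].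
  by rewrite /crosses /= /split_end !in_set2 h1 h2 /= !inE.
have E1 x : crosses s t [set v] x -> x \in [set e; e'] ->
    crosses split_s split_t A (Some x) = (None \in A) (+) (other_end x \in B) /\
    crosses s t B x = (v \in B) (+) (other_end x \in B).
  rewrite /crosses /= /split_end /other_end !in_set1 => cx ->.
  move: cx; case: eqVneq => [->|_]; case: eqVneq => [->|_] //= _; rewrite !inE //.
  by split=> //; rewrite addbC.
have [-> ->] := E1 e ce (set21 _ _); have [-> ->] := E1 e' ce' (set22 _ _).
rewrite /crosses /= [v \in B]inE; set S := bigop _ _ _.
case: (Some v \in A); case: (None \in A); case: (_ \in B); case: (_ \in B) => /=; lia.
Qed.
(** Up to complement, [v] is outside [A]. The cut can shrink only when [A] contains the new vertex
    and the other ends of both [e] and [e']. It then loses one edge, and [loose] guarantees four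
    beforehand. *)
Lemma cut_split_ge3 (A : {set option V}) :
  A != set0 -> A != setT -> (2 < cut split_s split_t A)%N.
Proof.
wlog vA : A / Some v \notin A => [wl A0 AT|A0 _].
  have [vA|] := boolP (Some v \in A); last by move/wl; apply.
  rewrite -cutC; apply: wl; first by rewrite in_setC vA.
    by apply: contraNneq AT => h; rewrite -[A]setCK h setC0.
  by apply: contraNneq A0 => h; rewrite -[A]setCK h setCT.
have /= := cut_split A; set B := [set x | Some x \in A].
have vB : v \notin B by rewrite inE.
have BT : B != setT by apply: contraNneq vB => ->; rewrite inE.
have jE y : crosses s t [set v] y -> joins s t [set v] B y = (other_end y \in B).
  rewrite /crosses /joins /other_end !in_set1.
  case: eqVneq => [->|_]; case: eqVneq => [->|_] //= _.
    by rewrite (negPf vB) /= orbF.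
  by rewrite andbT.
have hB : B != set0 -> (2 < cut s t B)%N by move=> B0; apply: cut3.
have hl := loose vB; rewrite !jE // in hl.
rewrite (negPf vB) /=; have [nA|nA] := boolP (None \in A).
  have [->|B0] := eqVneq B set0.
    by rewrite !inE /= => h; clear -h; lia.
  have {hB} := hB B0.
  by case: (_ \in B) hl; case: (_ \in B) => /= h1 h2 h3; try have := h1 isT isT;
    clear -h2 h3; lia.
have {hB} : (2 < cut s t B)%N.
  apply: hB; apply: contraNneq A0 => h; apply/eqP/setP => -[x|].
    by have /setP/(_ x) := h; rewrite !inE.
  by rewrite (negPf nA) inE.
by case: (_ \in B); case: (_ \in B) => /= h1 h2; clear -h1 h2; lia.
Qed.

(** The new vertex has degree 3 and the degree of [v] drops by one, so the total excess over 3 can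
    serve as the induction measure. *)
Lemma split_excess :
  (3 < cut s t [set v])%N ->
  (\sum_x (cut split_s split_t [set x] - 3) <
   \sum_x (cut s t [set x] - 3))%N.
Proof.
move=> v4; rewrite big_option.
have hv y : crosses s t [set v] y -> (other_end y == v) = false.
  rewrite /crosses /other_end !in_set1.
  by case: (eqVneq (s y) v) => [_|/negPf-> //]; case: eqVneq.
have S1 x : [set y | Some y \in [set Some x]] = [set x].
  by apply/setP => y; rewrite !inE.
have N0 : (cut split_s split_t [set None] = 3)%N.
  have /= := cut_split [set None].
  have -> : [set x | Some x \in [set None]] = set0 :> {set V}.
    by apply/setP => x; rewrite !inE.
  have -> : cut s t set0 = 0%N by rewrite /cut big1 // => x _; rewrite /crosses !inE.
  by rewrite !inE /=; lia.
rewrite /= N0 subnn add0n (bigD1 v) //= [X in (_ < X)%N](bigD1 v) //=.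
have cv : (cut split_s split_t [set Some v]).+1 = cut s t [set v].
  by have /= := cut_split [set Some v]; rewrite S1 !inE eqxx !hv //=; lia.
rewrite -cv in v4 *; rewrite (eq_bigr (fun x => cut s t [set x] - 3)%N); first by lia.
move=> x xv; congr (_ - 3)%N; have /= := cut_split [set Some x].
rewrite S1 !in_set1 [v == x]eq_sym (negPf xv) /=; lia.
Qed.

(** Contracting the new edge adds the boundaries at its two ends, where its own value cancels. Flows
    of the split graph therefore restrict to flows of the original one. *)
Lemma bd_split (Gam : zmodType) (g : option E -> Gam) (x : V) :
  bd s t (fun y => g (Some y)) x =
  bd split_s split_t g (Some x) + bd split_s split_t g None *+ (x == v).
Proof.
have part (u : E -> V) : \sum_(y | u y == x) g (Some y) =
    \sum_(y | split_end (u y) y == Some x) g (Some y) +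
    (\sum_(y | split_end (u y) y == None) g (Some y)) *+ (x == v).
  rewrite -sumrMnl !(big_mkcond (fun y => _ == _)) -big_split /=.
  apply: eq_bigr => y _; rewrite /split_end.
  case: (y \in _) => /=; last by rewrite addr0.
  case: (eqVneq (u y) v) => [->|uv] /=; last first.
    by rewrite addr0.
  by rewrite add0r eq_sym; case: (x == v).
have zid (a b c d z : Gam) : a + c - (b + d) = z + a - b + (c - (z + d)).
  rewrite (opprD b) (opprD z) (addrC z) -[a + z - b]addrA [RHS]addrACA.
  by rewrite (addrACA z) subrr add0r.
have sumO (F : option E -> option V) z :
    \sum_(y | F y == z) g y = (if F None == z then g None else 0) +
      \sum_(y | F (Some y) == z) g (Some y).
  by rewrite big_mkcond big_option /= -big_mkcond.
rewrite /bd !part !sumO //=. case: (eqVneq x v) => [->|xv].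
  by rewrite eqxx !mulr1n !add0r [LHS](zid _ _ _ _ (g None)).
have -> : (Some v == Some x) = false by apply/eqP => -[h]; rewrite h eqxx in xv.
by rewrite !mulr0n !addr0 !add0r.
Qed.

End Split.
End Splitting.

Theorem existence (V E : finType) (s t : E -> V) (f2 : E -> 'F_2) (f3 : E -> 'F_3) :
  (forall A : {set V}, A != set0 -> A != setT -> (2 < cut s t A)%N) ->
  (1 < #|V|)%N ->
  exists phi2 phi3, [/\ flow s t phi2, flow s t phi3 &
    forall e, (phi2 e != f2 e) || (phi3 e != f3 e)].
Proof.
have [m] := ubnP (\sum_v (cut s t [set v] - 3))%N.
elim: m => // m IH in V E s t f2 f3 *; rewrite ltnS => hm cut3 V2.
have [/existsP[v v4]|deg3] := boolP [exists v, (3 < cut s t [set v])%N]; last first.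
  apply: cubic_existence => // v.
  by rewrite leqNgt; apply: contraNN deg3 => v4; apply/existsP; exists v.
have [e [e' [ee' ce ce' loose]]] := split_pair cut3 v4.
(* The forbidden value [z] on the new edge is arbitrary, as that edge is dropped afterwards. *)
pose g T (f : E -> T) z (y : option E) := if y is Some y then f y else z.
have [||| phi2 [phi3 [fl2 fl3 h]]] :=
  IH _ _ (split_s s v e e') (split_t t v e e') (g _ f2 0) (g _ f3 0).
- by apply: leq_trans (split_excess ee' ce ce' v4) hm.
- exact: cut_split_ge3.
- by rewrite card_option ltnS ltnW.
exists (fun y => phi2 (Some y)), (fun y => phi3 (Some y)); split=> [x|x|y].
- by rewrite (bd_split s t v e e') !fl2 mul0rn addr0.
- by rewrite (bd_split s t v e e') !fl3 mul0rn addr0.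
exact: (h (Some y)).
Qed.

(** * Non-zeros of products of affine forms over F_3 *)

(* On sequences of size [n], [f] is a polynomial of total degree less than [k];
   as for [size] of polynomials, [k = 0] means that [f] vanishes there. *)
Fixpoint psize (n k : nat) (f : seq 'F_3 -> 'F_3) : Prop :=
  if n is n'.+1 then
    exists f0 f1 f2, [/\ psize n' k f0, psize n' k.-1 f1, psize n' k.-2 f2 &
      forall x s, size s = n' -> f (x :: s) = f0 s + f1 s * x + f2 s * x ^+ 2]
  else k = 0%N -> f [::] = 0.

Lemma psize0 n f : psize n 0 f -> forall s, size s = n -> f s = 0.
Proof.
elim: n f => [|n IH] f /=; first by move=> h s /size0nil->; exact: h.
case=> f0 [f1 [f2 [h0 h1 h2 hf]]] [|x s] //= [sn].
by rewrite hf // (IH _ h0) // (IH _ h1) // (IH _ h2) // !mul0r !addr0.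
Qed.

Lemma eq_psize n k f g : (forall s, size s = n -> f s = g s) ->
  psize n k f -> psize n k g.
Proof.
case: n => [|n] fg /=; first by rewrite -fg.
case=> f0 [f1 [f2 [h0 h1 h2 hf]]]; exists f0, f1, f2; split=> // x s sn.
by rewrite -fg ?hf //= sn.
Qed.

Lemma psize_cst0 n k : psize n k (fun=> 0).
Proof.
elim: n k => [|n IH] k //=; exists (fun=> 0), (fun=> 0), (fun=> 0).
by split=> // x s _; rewrite !mul0r !addr0.
Qed.

Lemma psize_leq n k k' f : (k <= k')%N -> psize n k f -> psize n k' f.
Proof.
elim: n k k' f => [|n IH] k k' f kk' /=.
  by move=> h k0; apply: h; apply/eqP; rewrite -leqn0 -k0.
case=> f0 [f1 [f2 [h0 h1 h2 hf]]]; exists f0, f1, f2; split=> //.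
- exact: IH h0.
- by apply: IH h1; lia.
by apply: IH h2; lia.
Qed.

Lemma psizeD n k f g : psize n k f -> psize n k g -> psize n k (fun s => f s + g s).
Proof.
elim: n k f g => [|n IH] k f g /=.
  by move=> hf hg k0; rewrite hf // hg // addr0.
case=> f0 [f1 [f2 [h0 h1 h2 hf]]] [g0 [g1 [g2 [h3 h4 h5 hg]]]].
exists (fun s => f0 s + g0 s), (fun s => f1 s + g1 s), (fun s => f2 s + g2 s).
by split; try exact: IH; move=> x s sn; rewrite hf // hg //; ring.
Qed.

Lemma psizeZ n k f c : psize n k f -> psize n k (fun s => f s * c).
Proof.
elim: n k f => [|n IH] k f /=; first by move=> hf k0; rewrite hf // mul0r.
case=> f0 [f1 [f2 [h0 h1 h2 hf]]].
exists (fun s => f0 s * c), (fun s => f1 s * c), (fun s => f2 s * c).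
by split; try exact: IH; move=> x s sn; rewrite hf //; ring.
Qed.

Fixpoint lin (c s : seq 'F_3) : 'F_3 :=
  if c is a :: c' then if s is x :: s' then a * x + lin c' s' else 0 else 0.

Lemma F3_cube (x : 'F_3) : x ^+ 3 = x.
Proof. by case: x => [[|[|[|//]]] ?]; apply: val_inj. Qed.

(** The product is expanded in the first variable, and the cubic term returns to the linear one by
    [F3_cube], where the larger bound of the linear coefficient absorbs it. *)
Lemma psizeM_affine n k f b c : size c = n ->
  psize n k f -> psize n k.+1 (fun s => f s * (b + lin c s)).
Proof.
elim: n k f c => [|n IH] k f [|a c] //= sc; case: k => [|k] hf.
  case: sc => sc; have [f0 [f1 [f2 [h0 h1 h2 ef]]]] := hf.
  exists (fun=> 0), (fun=> 0), (fun=> 0); split; try exact: psize_cst0.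
  move=> x s sn; rewrite ef // (psize0 h0) // (psize0 h1) // (psize0 h2) //; ring.
case: sc => sc; have [f0 [f1 [f2 [h0 h1 h2 ef]]]] := hf.
exists (fun s => f0 s * (b + lin c s)),
  (fun s => f1 s * (b + lin c s) + (f0 s + f2 s) * a),
  (fun s => f2 s * (b + lin c s) + f1 s * a); split => /=.
- exact: IH.
- apply: psizeD; first exact: IH.
  by apply: psizeZ; apply: psizeD => //; apply: psize_leq h2; lia.
- apply: psizeD; last exact: psizeZ.
  (* At [k = 0] the bound required is 0, while the induction hypothesis would give 1; but [f2]
     vanishes there. *)
  case: k h2 {h0 h1 hf} => [|k] h2; last exact: IH.
  by apply: eq_psize (psize_cst0 _ _) => s sn; rewrite (psize0 h2) // mul0r.
move=> x s sn; rewrite ef //.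
transitivity (f0 s * (b + lin c s) + (f1 s * (b + lin c s) + f0 s * a) * x +
  (f2 s * (b + lin c s) + f1 s * a) * x ^+ 2 + f2 s * a * x ^+ 3); first ring.
rewrite F3_cube; ring.
Qed.

Lemma psize_prod n (L : seq ('F_3 * seq 'F_3)) :
  all (fun p => size p.2 == n) L ->
  psize n (size L).+1 (fun s => \prod_(p <- L) (p.1 + lin p.2 s)).
Proof.
elim: L => [_|[b c] L IH /= /andP[/eqP sc sL]].
  have h m : psize m 1 (fun=> 1).
    elim: m => [|m IH] //=; exists (fun=> 1), (fun=> 0), (fun=> 0).
    by split; try exact: psize_cst0; rewrite // => x s _; rewrite !mul0r !addr0.
  by apply: eq_psize (h n) => s _; rewrite big_nil.
apply: eq_psize (psizeM_affine b sc (IH sL)) => s _.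
by rewrite big_cons mulrC.
Qed.

Lemma big_tuple_cons (T : finType) n (F : n.+1.-tuple T -> nat) :
  (\sum_t F t = \sum_(s : n.-tuple T) \sum_x F [tuple of x :: s])%N.
Proof.
rewrite exchange_big pair_big /=.
rewrite (reindex (fun p : T * n.-tuple T => [tuple of p.1 :: p.2])) //=.
exists (fun t => (thead t, [tuple of behead t])) => [[x s] _|t _] /=.
  by congr (_, _); apply: val_inj.
by rewrite -tuple_eta.
Qed.

(** A non-zero polynomial of degree d at most 2 has at most d roots among the three elements. *)
Lemma F3_count (a b c : 'F_3) :
  (\sum_x (a + b * x + c * x ^+ 2 != 0)%R >=
    if c != 0%R then 1 else if b != 0%R then 2 else if a != 0%R then 3 else 0)%N.
Proof.
rewrite !big_ord_recl big_ord0.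
by case: a => [[|[|[|//]]] ?]; case: b => [[|[|[|//]]] ?]; case: c => [[|[|[|//]]] ?].
Qed.

(* The minimum distance bound for generalised Reed-Muller codes over F_3, in
   the weakened form (min weight)^2 >= 3^(2n - degree). *)
Lemma psize_support n k f : psize n k.+1 f -> (exists2 s, size s = n & f s != 0) ->
  (3 ^ (2 * n) <= (\sum_(s : n.-tuple 'F_3) (f s != 0)%R) ^ 2 * 3 ^ k)%N.
Proof.
elim: n k f => [|n IH] k f.
  move=> _ [s /size0nil-> f0]; rewrite (bigD1 [tuple]) //= f0.
  by rewrite expn0 muln_gt0 expn_gt0 addn_gt0 /= expn_gt0.
case=> f0 [f1 [f2 [/= h0 h1 h2 ef]]] nz; rewrite big_tuple_cons.
have low c (g : seq 'F_3 -> 'F_3) :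
    (forall s, size s = n -> (g s != 0)%R -> c <= \sum_x (f (x :: s) != 0)%R)%N ->
    (c * \sum_(s : n.-tuple 'F_3) (g s != 0)%R <=
     \sum_(s : n.-tuple 'F_3) \sum_x (f (x :: s) != 0)%R)%N.
  move=> h; rewrite big_distrr; apply: leq_sum => s _ /=.
  by case: eqVneq => g0; rewrite ?muln0 // muln1 h ?size_tuple.
have key s : size s = n -> (\sum_x (f (x :: s) != 0)%R >=
    if f2 s != 0%R then 1 else if f1 s != 0%R then 2 else
    if f0 s != 0%R then 3 else 0)%N.
  by move=> sn; under eq_bigr do rewrite ef //; exact: F3_count.
have dec (g : seq 'F_3 -> 'F_3) :
    (exists2 s, size s = n & g s != 0) \/ forall s, size s = n -> g s = 0.
  have [/existsP[s gs]|h] := boolP [exists s : n.-tuple 'F_3, g s != 0].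
    by left; exists s; rewrite ?size_tuple.
  right=> s /eqP sn; apply/eqP; rewrite -[_ == _]negbK.
  by apply: contra h => gs; apply/existsP; exists (Tuple sn).
set T := bigop _ _ _ in low *.
have e9 : (3 ^ (2 * n.+1) = 9 * 3 ^ (2 * n))%N by rewrite mulnS expnD.
rewrite e9 {e9}.
(* One more variable needs a factor 9. The top coefficient that is not identically zero provides it:
   [f2] gives [1 ^ 2 * 3 ^ 2], [f1] gives [2 ^ 2 * 3 = 12] and [f0] gives [3 ^ 2], where the powers
   of 3 come from the drop in degree. *)
have [nz2|z2] := dec f2.
  have l2 : (1 * \sum_(s : n.-tuple 'F_3) (f2 s != 0)%R <= T)%N.
    by apply: low => s /key + h; rewrite h.
  case: k h2 {h0 h1} => [|[|k]] h2; try by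
    have [s sn /eqP[]] := nz2; exact: psize0 h2 s sn.
  have := IH _ _ h2 nz2; rewrite mul1n in l2; rewrite -(leq_sqr) in l2.
  rewrite !expnS; move: l2; set a := (_ ^ 2)%N; set b := (_ ^ 2)%N.
  move: (3 ^ k)%N (3 ^ _)%N => p q ab h.
  have := leq_mul ab (leqnn p); clear -h; lia.
have [nz1|z1] := dec f1.
  have l1 : (2 * \sum_(s : n.-tuple 'F_3) (f1 s != 0)%R <= T)%N.
    by apply: low => s sn h; have := key s sn; rewrite z2 // eqxx h.
  case: k h1 {h0 h2} => [|k] h1; first by
    have [s sn /eqP[]] := nz1; exact: psize0 h1 s sn.
  have := IH _ _ h1 nz1; rewrite -(leq_sqr) expnMn in l1.
  rewrite !expnS; move: l1; set a := (_ ^ 2)%N; set b := (T * _)%N.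
  move: (3 ^ k)%N (3 ^ _)%N => p q ab h.
  have := leq_mul ab (leqnn p); clear -h; lia.
have l0 : (3 * \sum_(s : n.-tuple 'F_3) (f0 s != 0)%R <= T)%N.
  by apply: low => s sn h; have := key s sn; rewrite z2 // z1 // eqxx h.
have nz0 : exists2 s, size s = n & f0 s != 0.
  have [[|x s] //= [sn]] := nz; rewrite ef // z1 // z2 // !mul0r !addr0 => fs.
  by exists s.
have := IH _ _ h0 nz0; rewrite -(leq_sqr) expnMn in l0.
move: l0; set a := (_ ^ 2)%N; set b := (T ^ 2)%N.
move: (3 ^ k)%N (3 ^ _)%N => p q ab h.
have := leq_mul ab (leqnn p); clear -h; lia.
Qed.

Lemma lin_nth n (c s : seq 'F_3) : size c = n -> size s = n ->
  lin c s = \sum_(i < n) c`_i * s`_i.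
Proof.
elim: n c s => [|n IH] [|a c] [|x s] //= => [_ _|[sc] [ss]].
  by rewrite big_ord0.
by rewrite big_ord_recl (IH c s).
Qed.

(** The product of the affine forms has degree at most [size L] and is non-zero exactly where [P]
    holds, so [psize_support] applies once one such point is known. *)
Lemma avoid_hyperplanes (E : finType) (L : seq ('F_3 * (E -> 'F_3)))
    (P := fun phi : E -> 'F_3 => all (fun p => p.1 + \sum_e p.2 e * phi e != 0) L) :
  (exists phi, P phi) ->
  (3 ^ (2 * #|E|) <= #|[set phi : {ffun E -> 'F_3} | P phi]| ^ 2 * 3 ^ size L)%N.
Proof.
case=> phi0 hphi0; pose n := #|E|.
pose L' := [seq (p.1, [seq p.2 e | e <- enum E]) | p <- L].
have sL' : all (fun p => size p.2 == n) L'.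
  rewrite all_map (eq_all (a2 := predT)) ?all_predT // => p /=.
  by rewrite size_map -cardE eqxx.
have sz (c : E -> 'F_3) : size [seq c e | e <- enum E] = #|E|.
  by rewrite size_map -cardE.
have nthE (c : E -> 'F_3) e : [seq c e | e <- enum E]`_(enum_rank e) = c e.
  by rewrite (nth_map e) ?nth_enum_rank // -cardE.
have linE (c phi : E -> 'F_3) :
    lin [seq c e | e <- enum E] [seq phi e | e <- enum E] = \sum_e c e * phi e.
  rewrite (@lin_nth #|E|) ?sz // (reindex (@enum_rank E)) /=; last first.
    by exists enum_val => x _; rewrite ?enum_rankK ?enum_valK.
  by apply: eq_bigr => e _; rewrite !nthE.
have PE (phi : E -> 'F_3) :
    P phi = (\prod_(p <- L') (p.1 + lin p.2 [seq phi e | e <- enum E]) != 0).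
  rewrite prodf_seq_neq0 all_map /P; apply: eq_all => p /=.
  by rewrite linE.
have := psize_support (psize_prod sL'); rewrite size_map => /(_ _)/leq_trans; apply.
  exists [seq phi0 e | e <- enum E]; first by rewrite size_map -cardE.
  by rewrite -PE.
rewrite leq_mul2r leq_sqr; apply/orP; right.
rewrite -sum1_card [X in (_ <= X)%N]big_mkcond /=.
pose h (s : n.-tuple 'F_3) : {ffun E -> 'F_3} := [ffun e => tnth s (enum_rank e)].
rewrite (reindex h) /=.
  apply: leq_sum => s _; rewrite inE PE.
  have -> : [seq h s e | e <- enum E] = s.
    apply: (@eq_from_nth _ (0 : 'F_3)) => [|i]; first by rewrite sz size_tuple.
    rewrite sz => iE; have [e0 ->] : exists e : E, i = enum_rank e :> nat.
      by exists (enum_val (Ordinal iE)); rewrite enum_valK.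
    by rewrite nthE ffunE; exact: tnth_nth.
  by case: (_ != 0).
pose h' (phi : {ffun E -> 'F_3}) : n.-tuple 'F_3 := [tuple phi (enum_val i) | i < n].
apply: onW_bij; exists h' => [s|phi].
  by apply: eq_from_tnth => i; rewrite tnth_mktuple ffunE enum_valK.
by apply/ffunP => e; rewrite ffunE tnth_mktuple enum_rankK.
Qed.

(** * Flows over F_2 *)

Lemma eq_bd_ends (V E : finType) (s t t' : E -> V) (Gam : zmodType)
    (g : E -> Gam) v :
  (forall e, g e != 0 -> t e = t' e) -> bd s t g v = bd s t' g v.
Proof.
move=> tt'; rewrite /bd; congr (_ - _).
rewrite big_mkcond [RHS]big_mkcond; apply: eq_bigr => e _.
by have [->|/tt'->//] := eqVneq (g e) 0; rewrite !if_same.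
Qed.

(* Two edges [e], [e'] meeting at [t e] carry the same flow as a single edge
   [e] leading directly to the other end [w] of [e']. *)
Lemma bd_merge (V E : finType) (s t : E -> V) (Gam : zmodType) (g : E -> Gam)
    (e e' : E) (w v : V) : e != e' ->
  [/\ s e' = t e, t e' = w & g e' = g e] \/
  [/\ t e' = t e, s e' = w & g e' = - g e] ->
  bd s t g v = bd s (fun y => if y == e then w else t y)
                  (fun y => if y == e' then 0 else g y) v.
Proof.
move=> ee' H; pose g0 y := if (y == e) || (y == e') then 0 else g y.
set t' := fun y => if y == e then w else t y.
have e'e : (e' == e) = false by rewrite eq_sym (negPf ee').
have -> : bd s t g v = bd s t g0 v + bd s t (single e (g e)) v +
    bd s t (single e' (g e')) v.
  rewrite -!bdD; apply: eq_bd => y; rewrite /g0 /single.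
  case: (eqVneq y e) => [->|_]; first by rewrite (negPf ee') add0r addr0.
  by case: eqVneq => [->|_]; rewrite ?addr0 ?add0r.
rewrite [RHS](_ : _ = bd s t' g0 v + bd s t' (single e (g e)) v); last first.
  rewrite -!bdD; apply: eq_bd => y; rewrite /g0 /single.
  case: (eqVneq y e) => [->|_]; first by rewrite (negPf ee') add0r.
  by case: eqVneq => [->|_]; rewrite ?addr0.
rewrite -(@eq_bd_ends _ _ s t t' _ g0); last first.
  by move=> y; rewrite /g0 /t'; case: (y == e); rewrite ?eqxx.
rewrite -addrA; congr (_ + _); rewrite !bd_single /t' eqxx.
case: H => -[-> -> ->]; first by rewrite addrA subrK.
by rewrite !mulNrn opprK [- _ + _]addrC addrA subrK.
Qed.

Lemma F2_cases (x : 'F_2) : x = (x != 0)%:R.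
Proof. by case: x => [[|[|//]] ?]; apply: val_inj. Qed.

(** Induction on the support. A loop is removed and gets the value 1. For a non-loop edge [e],
    parity at [t e] provides a second support edge [e'] there; the two are merged into one edge, and
    the value found for it is copied back to [e'] with the sign dictated by its orientation. *)
Lemma eulerian_orientation (V E : finType) (s t : E -> V) (chi : E -> 'F_2) :
  flow s t chi ->
  exists psi : E -> 'F_3, flow s t psi /\ forall e, (psi e == 0) = (chi e == 0).
Proof.
have [m] := ubnP #|[set e | chi e != 0]|.
elim: m => // m IH in s t chi *; rewrite ltnS => hm fchi.
have [/existsP[e che]|none] := boolP [exists e, chi e != 0]; last first.
  exists (fun=> 0); split=> [v|e]; first exact: bd0.
  apply/esym; rewrite eqxx -[_ == _]negbK; apply/negP => che.
  by case/negP: none; apply/existsP; exists e.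
pose del e' x : 'F_2 := if x == e' then 0 else chi x.
have small e' : chi e' != 0 -> (#|[set x | (del e' x != 0)%R]| < m)%N.
  move=> che'; apply: leq_trans hm; apply: proper_card.
  rewrite properE; apply/andP; split.
    by apply/subsetP => x; rewrite !inE /del; case: (x == e') => //; rewrite eqxx.
  by apply/subsetPn; exists e'; rewrite !inE /del ?eqxx.
have [eloop|enl] := eqVneq (s e) (t e).
  have [|psi [fpsi hpsi]] := IH s t (del e) (small e che).
    move=> v; rewrite -(fchi v) (@eq_bd _ _ s t _ chi
      (fun x => del e x + single e (chi e) x)).
      by rewrite bdD bd_single eloop subrr addr0.
    by move=> x; rewrite /del /single; case: eqVneq => [->|_]; rewrite ?add0r ?addr0.
  exists (fun x => psi x + single e 1 x); split=> [v|x].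
    by rewrite bdD fpsi bd_single eloop subrr addr0.
  rewrite /single; have := hpsi x; rewrite /del; case: (eqVneq x e) => [->|_] /=; last by rewrite addr0.
  by rewrite eqxx => /eqP->; rewrite add0r oner_eq0 (negPf che).
have [e' [che' e'e ce']] : exists e', [/\ chi e' != 0, e' != e &
    (s e' == t e) (+) (t e' == t e)].
  have [/existsP[e' /and3P[]]|none] := boolP [exists e', [&& chi e' != 0, e' != e
    & (s e' == t e) (+) (t e' == t e)]]; first by exists e'.
  (* Without such an [e'], all other edges cancel at [t e], and only the non-zero value at [e]
     remains. *)
  have /eqP[] : bd s t chi (t e) != 0; last by rewrite fchi.
  rewrite /bd (big_mkcond (fun x => s x == _)) (big_mkcond (fun x => t x == _)).
  rewrite -sumrB (bigD1 e) //= big1 => [|x xe].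
    by rewrite (negPf enl) eqxx sub0r addr0 oppr_eq0.
  have := none; rewrite negb_exists => /forallP/(_ x).
  rewrite xe /= negb_and negbK; case/orP => [/eqP->|].
    by rewrite !if_same subrr.
  by case: (s x == t e); case: (t x == t e) => //; rewrite subrr.
have ee' : e != e' by rewrite eq_sym.
have one x : chi x != 0 -> chi x = 1 by move=> h; rewrite [chi x]F2_cases h.
have opp1 : (- 1 : 'F_2) = 1 by apply: val_inj.
move: ce'; have [s' /= t'|s' /= /eqP t'] := eqVneq (s e') (t e).
  have [|psi [fpsi hpsi]] := IH s (fun y => if y == e then t e' else t y) (del e') (small e' che').
    by move=> v; rewrite -(fchi v); apply/esym/(@bd_merge _ _ s t _ chi) => //;
      left; split; rewrite // (one e) // (one e').
  exists (fun y => if y == e' then psi e else psi y); split=> [v|y].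
    rewrite (bd_merge (w := t e') v ee'); last first.
      by left; split; rewrite // eqxx (negPf ee').
    rewrite -[RHS](fpsi v); apply: eq_bd => y; case: (eqVneq y e') => [->|//].
    by apply/esym/eqP; rewrite hpsi /del eqxx.
  have := hpsi y; rewrite /del; case: (eqVneq y e') => [->|//] _; rewrite hpsi.
  by rewrite /del (negPf ee') (one e) // (one e').
have [|psi [fpsi hpsi]] := IH s (fun y => if y == e then s e' else t y) (del e') (small e' che').
  by move=> v; rewrite -(fchi v); apply/esym/(@bd_merge _ _ s t _ chi) => //;
    right; split; rewrite // (one e) // (one e') // opp1.
exists (fun y => if y == e' then - psi e else psi y); split=> [v|y].
  rewrite (bd_merge (w := s e') v ee'); last first.
    by right; split; rewrite // eqxx (negPf ee').
  rewrite -[RHS](fpsi v); apply: eq_bd => y; case: (eqVneq y e') => [->|//].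
  by apply/esym/eqP; rewrite hpsi /del eqxx.
have := hpsi y; rewrite /del; case: (eqVneq y e') => [->|//] _; rewrite oppr_eq0 hpsi.
by rewrite /del (negPf ee') (one e) // (one e').
Qed.

(** The functions supported on [S] are sorted by boundary. There are at most [2 ^ #|V|] classes, and
    subtracting a fixed member embeds each class into the flows. *)
Lemma card_F2_flows (V E : finType) (s t : E -> V) (S : {set E}) :
  (2 ^ #|S| <= #|[set chi : {ffun E -> 'F_2} |
      [forall v, bd s t chi v == 0%R] && [forall e, (e \notin S) ==> (chi e == 0%R)]]|
    * 2 ^ #|V|)%N.
Proof.
set K := [set _ | _].
pose X := [set chi : {ffun E -> 'F_2} | [forall e, (e \notin S) ==> (chi e == 0)]].
have cX : #|X| = (2 ^ #|S|)%N.
  transitivity (#|'F_2| ^ #|S|)%N; last by rewrite card_ord.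
  rewrite -(card_pffun_on 0 (mem S) (mem 'F_2)) cardsE; apply: eq_card => chi.
  rewrite !inE; apply/forallP/pffun_onP => [h|[h _] e].
    split; last by move=> ? _.
    by apply/subsetP => e; rewrite inE => he; have := h e; rewrite (negPf he); case: (e \in S).
  by apply/implyP => eS; apply: contraNT eS => he; apply: (subsetP h); rewrite inE.
have cV : #|{ffun V -> 'F_2}| = (2 ^ #|V|)%N by rewrite card_ffun card_ord.
rewrite -cX -cV -sum1_card.
rewrite (partition_big (fun chi : {ffun E -> 'F_2} => [ffun v => bd s t chi v]) predT) //=.
rewrite mulnC -sum_nat_const; apply: leq_sum => b _.
have [chi0 /andP[/= x0 /eqP b0]|none] :=
  pickP [pred chi | (chi \in X) && ([ffun v => bd s t chi v] == b)]; last first.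
  by rewrite big_pred0.
rewrite sum1dep_card -(card_imset (mem [set chi | (chi \in X) && ([ffun v => bd s t chi v] == b)]) (addrI (- chi0))).
apply/subset_leq_card/subsetP => _ /imsetP[chi + ->].
rewrite !inE => /andP[hx /eqP hb]; apply/andP; split; apply/forallP.
  move=> v; rewrite (@eq_bd _ _ _ _ _ _ (fun e => chi e - chi0 e)).
    rewrite bdB; have /ffunP/(_ v) := hb; rewrite -b0 !ffunE => ->.
    by rewrite subrr.
  by move=> e; rewrite !ffunE addrC.
move=> e; apply/implyP => eS; rewrite !ffunE.
move: x0; rewrite inE => /forallP/(_ e); rewrite eS => /eqP->.
by have /forallP/(_ e) := hx; rewrite eS => /eqP->; rewrite oppr0 addr0.
Qed.

(** * Counting solutions *)

Import Order.TTheory Num.Theory.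

Lemma bd_lin (V E : finType) (s t : E -> V) (R : pzRingType) (g : E -> R) v :
  bd s t g v = \sum_e ((s e == v)%:R - (t e == v)%:R) * g e.
Proof.
rewrite /bd !(big_mkcond (fun e => _ == v)) -sumrB; apply: eq_bigr => e _.
by rewrite mulrBl !mulr_natl !mulrb.
Qed.

(** Expresses a linear equation through two affine forms being non-zero, so that conservation at the
    vertices costs [2 * #|V|] forms. *)
Lemma F3_flow_test (x : 'F_3) : 1 + x != 0 -> 1 - x != 0 -> x = 0.
Proof. by case: x => [[|[|[|//]]] ?] // _ _; apply: val_inj. Qed.

Section Counting.
Variables (V E : finType) (s t : E -> V) (f2 : E -> 'F_2) (f3 : E -> 'F_3).

Definition sols : {set {ffun E -> 'F_2} * {ffun E -> 'F_3}} :=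
  [set p : {ffun E -> 'F_2} * {ffun E -> 'F_3} |
    [&& [forall v, bd s t p.1 v == 0], [forall v, bd s t p.2 v == 0] &
    [forall e, (p.1 e != f2 e) || (p.2 e != f3 e)]]].

Lemma solsP (p : {ffun E -> 'F_2} * {ffun E -> 'F_3}) :
  reflect [/\ flow s t p.1, flow s t p.2 &
    forall e, (p.1 e != f2 e) || (p.2 e != f3 e)] (p \in sols).
Proof.
rewrite inE; apply: (iffP and3P).
  by case=> /forallP h1 /forallP h2 /forallP h3; split=> // v; apply/eqP.
by case=> h1 h2 h3; split; apply/forallP => x //; apply/eqP.
Qed.

Variables (a : {ffun E -> 'F_2}) (b : {ffun E -> 'F_3}).
Hypothesis ab : (a, b) \in sols.
Let A2 := [set e | a e == f2 e].
Let A3 := [set e | b e == f3 e].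

Let fa : flow s t a. Proof. by case/solsP: ab. Qed.
Let fb : flow s t b. Proof. by case/solsP: ab. Qed.
Let ok e : (a e != f2 e) || (b e != f3 e). Proof. by case/solsP: ab. Qed.

(** The first component alone makes the new solutions distinct, so [g] is unconstrained. *)
Lemma sols_lower2 (S : {set E}) (g : {ffun E -> 'F_2} -> {ffun E -> 'F_3}) :
  (forall chi : {ffun E -> 'F_2}, flow s t chi ->
    (forall e, e \notin S -> chi e = 0) -> (a + chi, g chi) \in sols) ->
  (2 ^ #|S| <= #|sols| * 2 ^ #|V|)%N.
Proof.
move=> H; apply: leq_trans (card_F2_flows s t S) _; rewrite leq_mul2r.
apply/orP; right; set K := [set _ | _].
have inj : injective (fun chi : {ffun E -> 'F_2} => (a + chi, g chi)).
  by move=> x y [/addrI].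
rewrite -(card_imset _ inj); apply/subset_leq_card/subsetP => _ /imsetP[chi + ->].
rewrite inE => /andP[/forallP h1 /forallP h2]; apply: H => [v|e eS].
  exact/eqP.
by have := h2 e; rewrite eS => /eqP.
Qed.

Lemma sols_lower_A3 : (2 ^ #|~: A3| <= #|sols| * 2 ^ #|V|)%N.
Proof.
apply: (@sols_lower2 _ (fun=> b)) => chi fchi h; apply/solsP; split=> //=.
  by move=> v; rewrite -[RHS](flowD fa fchi v); apply: eq_bd => e; rewrite ffunE.
move=> e; have [eA|] := boolP (e \in A3); last by rewrite inE orbC => ->.
by have := ok e; rewrite ffunE h ?addr0 // in_setC eA.
Qed.

Lemma sols_lower_N : (2 ^ #|A2 :|: A3| <= #|sols| * 2 ^ #|V|)%N.
Proof.
have /fin_all_exists[psi hpsi] (chi : {ffun E -> 'F_2}) :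
    exists psi : {ffun E -> 'F_3}, flow s t chi ->
      flow s t psi /\ forall e, (psi e == 0) = (chi e == 0).
  have [/forallP fc|nf] := boolP [forall v, bd s t chi v == 0].
    have [|psi [h1 h2]] := @eulerian_orientation _ _ s t chi; first by move=> v; apply/eqP.
    exists [ffun e => psi e] => _; split=> [v|e]; last by rewrite ffunE.
    by rewrite -[RHS](h1 v); apply: eq_bd => e; rewrite ffunE.
  by exists 0 => fc; case/negP: nf; apply/forallP => v; rewrite fc.
apply: (@sols_lower2 _ (fun chi => b + psi chi)) => chi fchi h.
have [fpsi hp] := hpsi chi fchi; apply/solsP; split=> /=.
- by move=> v; rewrite -[RHS](flowD fa fchi v); apply: eq_bd => e; rewrite ffunE.
- by move=> v; rewrite -[RHS](flowD fb fpsi v); apply: eq_bd => e; rewrite ffunE.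
move=> e; rewrite !ffunE; have hpe := hp e.
have [ce|ce] := eqVneq (chi e) 0.
  by move: hpe; rewrite ce eqxx => /eqP->; rewrite !addr0.
(* Both components change on the support of [chi], and at each such edge one of them agreed before;
   that one now differs. *)
have : e \in A2 :|: A3 by apply: contraNT ce => eA; rewrite h.
rewrite !inE => /orP[] /eqP <-.
  by rewrite -subr_eq0 [_ + chi e]addrC addrK ce.
by rewrite orbC -subr_eq0 [_ + psi chi e]addrC addrK hpe ce.
Qed.

Lemma sols_lower_A2 : (3 ^ (2 * #|E|) <= #|sols| ^ 2 * 3 ^ (2 * #|V| + #|A2|))%N.
Proof.
pose c v e : 'F_3 := (s e == v)%:R - (t e == v)%:R.
(* The first two families force [psi] to be a flow through [F3_flow_test]; the third keeps [b + psi]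
   off [f3] on [A2]. All are non-zero at [psi = 0] because [A2] and [A3] are disjoint. *)
pose L := [seq (1, c v) | v <- enum V] ++ [seq (1, fun e => - c v e) | v <- enum V]
  ++ [seq (b e - f3 e, fun x => (x == e)%:R) | e <- enum A2].
have sL : size L = (2 * #|V| + #|A2|)%N.
  have eV : size (enum V) = #|V| by rewrite -cardE.
  have eA : size (enum A2) = #|A2| by rewrite -cardE.
  by rewrite !size_cat !(size_map _ (enum V)) (size_map _ (enum A2)) eV eA mul2n -addnn addnA.
have delta e (psi : E -> 'F_3) : \sum_x (x == e)%:R * psi x = psi e.
  rewrite (bigD1 e) //= eqxx mul1r big1 ?addr0 // => x /negPf->.
  by rewrite mul0r.
have := @avoid_hyperplanes E L; rewrite sL => /(_ _)/leq_trans; apply.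
  exists (fun=> 0); rewrite !all_cat !all_map; apply/and3P; split.
  - by apply/allP => v _ /=; rewrite big1 ?addr0 // => e _; rewrite mulr0.
  - by apply/allP => v _ /=; rewrite big1 ?addr0 // => e _; rewrite mulr0.
  apply/allP => e; rewrite mem_enum inE /= delta addr0 subr_eq0 => h.
  by have := ok e; rewrite h.
rewrite leq_mul2r leq_sqr; apply/orP; right.
have inj : injective (fun psi : {ffun E -> 'F_3} => (a, b + psi)).
  by move=> x y [/addrI].
rewrite -(card_imset _ inj); apply/subset_leq_card/subsetP => _ /imsetP[psi + ->].
rewrite inE !all_cat !all_map => /and3P[/allP h1 /allP h2 /allP h3].
have fpsi : flow s t psi.
  move=> v; have vE : v \in Finite.enum V by rewrite -enumT mem_enum.
  apply: F3_flow_test; rewrite bd_lin; first exact: h1 v vE.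
  have := h2 v vE; rewrite /=; congr (_ + _ != _).
  by rewrite -sumrN; apply: eq_bigr => e _; rewrite mulNr.
apply/solsP; split=> //=.
  by move=> v; rewrite -[RHS](flowD fb fpsi v); apply: eq_bd => e; rewrite ffunE.
move=> e; have [ea|//] := eqVneq (a e) (f2 e).
have eE : e \in enum A2 by rewrite mem_enum inE ea.
have := h3 e eE; rewrite /= delta ffunE.
by rewrite addrAC subr_eq0.
Qed.

Lemma sols_many k : (3 * #|V| <= 2 * #|E|)%N -> (4 * k + #|V| <= #|E|)%N ->
  (2 ^ k <= #|sols|)%N.
Proof.
move=> VE kE; rewrite leqNgt; apply/negP => small.
have h1 : (#|~: A3| < #|V| + k)%N.
  rewrite -(ltn_exp2l (m := 2)) // expnD mulnC.
  by apply: leq_ltn_trans sols_lower_A3 _; rewrite ltn_mul2r expn_gt0.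
have h2 : (#|A2 :|: A3| < #|V| + k)%N.
  rewrite -(ltn_exp2l (m := 2)) // expnD mulnC.
  by apply: leq_ltn_trans sols_lower_N _; rewrite ltn_mul2r expn_gt0.
(* Here [#|sols| < 2 ^ k] is weakened to [#|sols| < 3 ^ k]. *)
have h3 : (2 * #|E| < 2 * k + (2 * #|V| + #|A2|))%N.
  rewrite -(ltn_exp2l (m := 3)) // expnD.
  apply: leq_ltn_trans sols_lower_A2 _; rewrite ltn_mul2r expn_gt0 /=.
  rewrite mulnC expnM ltn_sqr; apply: leq_trans small _.
  by case: (k) => // k'; rewrite leq_exp2r.
have d : [disjoint A2 & A3].
  rewrite disjoint_subset; apply/subsetP => e; rewrite !inE => h.
  by have := ok e; rewrite h.
have c1 := cardsC A3; have c2 : #|A2 :|: A3| = (#|A2| + #|A3|)%N.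
  by apply/eqP; rewrite (leq_card_setU _ _).2.
(* Adding [h1], [h2] and [h3] gives [3 * #|E| < 4 * #|V| + 4 * k]; with [kE] this yields
   [2 * #|E| < 3 * #|V|], against [VE]. *)
move: VE kE h1 h2 h3 c1; rewrite c2; clear; lia.
Qed.

End Counting.

(* 3 and 4 are the idempotents of Z_6. *)
Definition crt (x : 'F_2) (y : 'F_3) : 'Z_6 := inZp (3 * x + 4 * y).

Lemma crtD x x' y y' : crt (x + x') (y + y') = crt x y + crt x' y'.
Proof.
by case: x => [[|[|//]] ?]; case: x' => [[|[|//]] ?]; case: y => [[|[|[|//]]] ?];
  case: y' => [[|[|[|//]]] ?]; apply: val_inj.
Qed.

Lemma crt_eq x x' y y' : (crt x y == crt x' y') = (x == x') && (y == y').
Proof.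
by case: x => [[|[|//]] ?]; case: x' => [[|[|//]] ?]; case: y => [[|[|[|//]]] ?];
  case: y' => [[|[|[|//]]] ?].
Qed.

Lemma crtK (z : 'Z_6) : crt (inZp z) (inZp z) = z.
Proof. by case: z => [[|[|[|[|[|[|//]]]]]] ?]; apply: val_inj. Qed.

Lemma crt_sum (I : finType) (P : pred I) (g : I -> 'F_2) (h : I -> 'F_3) :
  \sum_(i | P i) crt (g i) (h i) = crt (\sum_(i | P i) g i) (\sum_(i | P i) h i).
Proof.
apply: (big_rec3 (fun a b c => a = crt b c)).
  exact: val_inj.
by move=> i a b c _ ->; rewrite crtD.
Qed.

(** * Transfer to the original definitions and the numerical estimate *)

Lemma edge_connected_cut (G : ograph) k (A : {set vert G}) : edge_connected G k ->
  A != set0 -> A != setT -> (k <= cut (@init G) (@term G) A)%N.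
Proof.
case/andP=> _ /forallP/(_ [set e | crosses (@init G) (@term G) A e]) H A0 AT.
rewrite leqNgt; apply/negP => cA.
have cF : #|[set e | crosses (@init G) (@term G) A e]| = cut (@init G) (@term G) A.
  rewrite -sum1_card big_mkcond; apply: eq_bigr => e _.
  by rewrite inE; case: (crosses _ _ _ _).
move: H; rewrite cF cA /= => /forallP H.
have [a aA] := set0Pn _ A0.
have [b bA] : exists b, b \notin A.
  by apply/existsP; apply: contraNT AT => h; apply/eqP/setP => b;
    rewrite inE; apply: contraNT h => bA; apply/existsP; exists b.
have := forallP (H a) b => /(closed_connect (a := A)); rewrite aA (negPf bA).
suff clA : closed (adj_del [set e | crosses (@init G) (@term G) A e]) A.
  by move/(_ clA).
move=> x y /existsP[e /andP[]]; rewrite inE /crosses.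
by move=> + /orP[] /andP[/eqP<- /eqP<-]; case: (_ \in A); case: (_ \in A).
Qed.

(** From [8 <= l] the logarithm is at least 3, and from [9 <= l] the root is at most [l / 3]; so the
    quotient is at most [l / 9], which the rounded quarter of [l] still exceeds. *)
Lemma exponent_bound (R : realType) (l : nat) : (11 <= l)%N ->
  Num.sqrt (l%:R : R) / log2 (l%:R : R) <= (l %/ 4)%:R.
Proof.
move=> l11; have l0 : (0 : R) < l%:R by rewrite ltr0n; lia.
have ln2 : (0 : R) < ln 2 by apply: ln_gt0; rewrite ltr1n.
have log3 : (3 : R) <= log2 l%:R.
  rewrite /log2 ler_pdivlMr // mulr_natl -lnXn // ler_ln ?posrE //.
    by rewrite -natrX ler_nat; lia.
  by rewrite -natrX ltr0n.
have sq : Num.sqrt (l%:R : R) <= l%:R / 3.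
  have l9 : (9 : R) <= l%:R by rewrite ler_nat; lia.
  rewrite -ler_sqr ?nnegrE ?sqrtr_ge0 ?divr_ge0 ?ler0n //.
  by rewrite sqr_sqrtr ?ler0n //; nra.
rewrite ler_pdivrMr; last by apply: lt_le_trans log3; rewrite ltr0n.
apply: le_trans sq _.
apply: (@le_trans _ _ ((l %/ 4)%:R * 3)); last by rewrite ler_wpM2l.
have : ((l%:R : R) <= 9 * (l %/ 4)%:R).
  by rewrite -natrM ler_nat; lia.
lra.
Qed.

Theorem theorem1p11 (R : realType) (G : ograph) (l : nat)
    (hG : edge_connected G 3)
    (hl : l = (#|edge G| - #|vert G|)%N)
    (hl11 : (11 <= l)%N)
    (f : edge G -> 'Z_6) :
  2 `^ (Num.sqrt (l%:R : R) / log2 (l%:R : R)) <=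
  #|[set phi : {ffun edge G -> 'Z_6} |
      is_flow phi && [forall e, phi e != f e]]|%:R.
Proof.
have cut3 A := @edge_connected_cut G 3 A hG.
have V2 : (1 < #|vert G|)%N by case/andP: hG.
pose f2 e : 'F_2 := inZp (f e); pose f3 e : 'F_3 := inZp (f e).
have [phi2 [phi3 [fl2 fl3 h23]]] := existence f2 f3 cut3 V2.
have ab : ([ffun e => phi2 e], [ffun e => phi3 e]) \in sols (@init G) (@term G) f2 f3.
  apply/solsP; split=> /= [v|v|e]; last by rewrite !ffunE.
    by rewrite -[RHS](fl2 v); apply: eq_bd => e; rewrite ffunE.
  by rewrite -[RHS](fl3 v); apply: eq_bd => e; rewrite ffunE.
(* All degrees are at least 3 by [cut3], and each edge is counted at most twice. *)
have VE : (3 * #|vert G| <= 2 * #|edge G|)%N.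
  have e1 : (3 * #|vert G| <= \sum_v cut (@init G) (@term G) [set v])%N.
    rewrite mulnC -sum_nat_const; apply: leq_sum => v _; apply: cut3.
      by apply/set0Pn; exists v; rewrite inE.
    by apply: contraTneq V2 => h; rewrite -leqNgt -cardsT -h cards1.
  apply: leq_trans e1 _; rewrite /cut exchange_big /= mulnC -sum_nat_const.
  apply: leq_sum => e _.
  apply: (@leq_trans (\sum_v ((init e == v) + (term e == v)))).
    apply: leq_sum => v _; rewrite /crosses !inE.
    by case: (_ == _); case: (_ == _).
  have one (w : vert G) : (\sum_v (w == v) = 1)%N.
    rewrite (bigD1 w) //= eqxx big1 ?addn0 // => v /negPf.
    by rewrite eq_sym => ->.
  by rewrite big_split /= !one.
have := sols_many (k := l %/ 4) ab VE.
have -> : (4 * (l %/ 4) + #|vert G| <= #|edge G|)%N by lia.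
move=> /(_ isT) many.
(* Combining components by [crt] is injective and respects sums. Two values of Z_6 differ as soon as
   one component does, so solutions become flows avoiding [f]. *)
have tosol : (#|sols (@init G) (@term G) f2 f3| <=
    #|[set phi : {ffun edge G -> 'Z_6} | is_flow phi && [forall e, phi e != f e]]|)%N.
  pose h (p : {ffun edge G -> 'F_2} * {ffun edge G -> 'F_3}) : {ffun edge G -> 'Z_6} :=
    [ffun e => crt (p.1 e) (p.2 e)].
  have inj : injective h.
    move=> [p1 p2] [q1 q2] /ffunP hpq.
    have {}hpq e : (p1 e == q1 e) && (p2 e == q2 e).
      by rewrite -crt_eq; have := hpq e; rewrite !ffunE /= => ->.
    by congr (_, _); apply/ffunP => e; have /andP[/eqP ? /eqP ?] := hpq e.
  rewrite -(card_imset _ inj); apply/subset_leq_card/subsetP => _ /imsetP[p + ->].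
  case/solsP => h2 h3 ok; rewrite inE; apply/andP; split; apply/forallP.
    have sumE (P : pred (edge G)) : \sum_(e | P e) h p e =
        crt (\sum_(e | P e) p.1 e) (\sum_(e | P e) p.2 e).
      by rewrite -crt_sum; apply: eq_bigr => e _; rewrite ffunE.
    move=> v; rewrite !sumE; apply/eqP; congr (crt _ _); apply/eqP;
      rewrite -subr_eq0; apply/eqP.
      rewrite -[RHS](h2 v) /bd; congr (_ - _); apply: eq_bigl => e; by rewrite inE.
    rewrite -[RHS](h3 v) /bd; congr (_ - _); apply: eq_bigl => e; by rewrite inE.
  move=> e; rewrite ffunE -[f e]crtK crt_eq negb_and; exact: ok.
apply: (@le_trans _ _ (2 `^ (l %/ 4)%:R)).
  by apply: ler_powR; rewrite ?ler1n // exponent_bound.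
rewrite powR_mulrn // -natrX ler_nat.
exact: leq_trans many tosol.
Qed.
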